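(* There exists an equivalent $C^\infty$-smooth norm on the real Banach space $c_0$ whose dual norm on $c_0^*$ is not strictly convex. Moreover, the norm $\|\cdot\|_\infty$ can be uniformly approximated on bounded sets by such norms; that is, for every $\varepsilon>0$ there exists an equivalent $C^\infty$-smooth norm $N$ on $c_0$, whose dual norm $N^*$ on $c_0^*$ is not strictly convex, such that $N(x)\le\|x\|_\infty\le(1+\varepsilon)N(x)$ for all $x\in c_0$.
   Context: $c_0$ is the space of real sequences converging to $0$, with the supremum norm $\|\cdot\|_\infty$. A norm on a Banach space $X$ is $C^\infty$-smooth if it is infinitely many times continuously Fréchet differentiable on $X\setminus\{0\}$. A norm $\|\cdot\|$ on $X$ is strictly convex if whenever $\|x\|\le1$, $\|y\|\le 1$ and $x\ne y$, one has $\left\|\frac{x+y}{2}\right\|<1$. For an equivalent norm $N$ on $X$, the dual norm on $X^*$ is $N^*(f)=\sup\{|f(x)|: N(x)\le 1\}$. *)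

(* Defs.v *)
From HB Require Import structures.
From mathcomp Require Import all_boot all_order all_algebra.
From mathcomp Require Import all_classical all_reals all_analysis.

Set Implicit Arguments.
Unset Strict Implicit.
Unset Printing Implicit Defensive.

Import Order.TTheory GRing.Theory Num.Theory.
Import numFieldNormedType.Exports.

Local Open Scope classical_set_scope.
Local Open Scope ring_scope.

Section C0.
Variable R : realType.

Definition c0_pred : {pred nat -> R} :=
  fun x => `[< x @ \oo --> (0 : R) >].

Record c0 := C0 { c0_val :> nat -> R ; c0_valP : c0_val \in c0_pred }.

HB.instance Definition _ := [isSub for c0_val].
HB.instance Definition _ := [Choice of c0 by <:].

Lemma c0_cvg (x : c0) : (x : nat -> R) @ \oo --> (0 : R).
Proof. exact: (asboolW (c0_valP x)). Qed.

Lemma c0_submod_closed : submod_closed c0_pred.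
Proof.
split=> [|a x y]; first by apply/asboolP; exact: cvg_cst.
move=> /asboolP x0 /asboolP y0; apply/asboolP.
have -> : (0 : R) = a *: 0 + 0 by rewrite scaler0 addr0.
by apply: cvgD => //; apply: cvgZr.
Qed.

HB.instance Definition _ :=
  GRing.SubChoice_isSubLmodule.Build R (nat -> R) c0_pred c0
    (GRing.submod_closed_semi c0_submod_closed).

Definition c0_norm (x : c0) : R := sup (range (fun n => `|x n|)).

Lemma c0_has_sup (x : c0) : has_sup (range (fun n => `|x n|)).
Proof.
split; first by exists `|x 0|, 0.
have /cvg_seq_bounded : cvgn (x : nat -> R) by apply/cvg_ex; exists 0; exact: c0_cvg.
move=> /pinfty_ex_gt0[M M0 xM]; exists M => _ [n _ <-].
exact: xM.
Qed.

Lemma c0_le_norm (x : c0) n : `|x n| <= c0_norm x.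
Proof. by apply: ub_le_sup; [case: (c0_has_sup x)|exists n]. Qed.

Lemma c0_norm_le (x : c0) M : (forall n, `|x n| <= M) -> c0_norm x <= M.
Proof. by move=> xM; apply: ge_sup; [exists `|x 0|, 0|move=> _ [n _ <-]]. Qed.

Lemma c0_normD (x y : c0) : c0_norm (x + y) <= c0_norm x + c0_norm y.
Proof.
apply: c0_norm_le => n; apply: le_trans (ler_normD _ _) _.
by apply: lerD; exact: c0_le_norm.
Qed.

Lemma c0_normZ (a : R) (x : c0) : c0_norm (a *: x) = `|a| * c0_norm x.
Proof.
have le_Z b z : c0_norm (b *: z) <= `|b| * c0_norm z.
  apply: c0_norm_le => n; have -> : (b *: z) n = b * z n by [].
  by rewrite normrM ler_wpM2l// c0_le_norm.
apply/eqP; rewrite eq_le le_Z/=.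
have [->|a0] := eqVneq a 0.
  rewrite normr0 mul0r; apply: le_trans (c0_le_norm _ 0); exact: normr_ge0.
rewrite -ler_pdivlMl ?normr_gt0// -normfV.
by rewrite -{1}(scale1r x) -(mulVf a0) -scalerA le_Z.
Qed.

Lemma c0_norm0_eq0 (x : c0) : c0_norm x = 0 -> x = 0.
Proof.
move=> x0; apply/val_inj/funext => n; apply/eqP.
by rewrite -normr_le0 -x0 c0_le_norm.
Qed.

HB.instance Definition _ :=
  Lmodule_isNormed.Build R c0 c0_normD c0_normZ c0_norm0_eq0.

Lemma c0_normE (x : c0) : `|x| = sup (range (fun n => `|x n|)).
Proof. by []. Qed.

Lemma c0_complete (F : set_system c0) :
  ProperFilter F -> cauchy F -> cvg F.
Proof.
move=> FF Fc.
have dist_le (y x : c0) n : `|y n - x n| <= `|y - x|.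
  exact: (c0_le_norm (y - x) n).
have near_c (e : R) : 0 < e ->
    exists y : c0, \forall x \near F, `|y - x| <= e.
  move=> e0; have [y yF] := (@cauchyP R c0 F FF).1 Fc e e0.
  by exists y; apply: filterS yF => x; rewrite -ball_normE /= => /ltW.
have coord (n : nat) : cvg ((fun x : c0 => x n) @ F).
  apply/cauchy_cvgP/cauchyP => e e0.
  have [y yF] := near_c (e / 2) (divr_gt0 e0 (ltr0n _ 2)).
  exists (y n); apply: filterS yF => x yx; rewrite -ball_normE /=.
  apply: le_lt_trans (le_trans (dist_le y x n) yx) _.
  by rewrite ltr_pdivrMr// ltr_pMr// ltr1n.
pose l n : R := lim ((fun x : c0 => x n) @ F).
have l_close e : 0 < e -> exists y : c0,
    (forall n, `|y n - l n| <= e) /\ \forall x \near F, `|y - x| <= e.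
  move=> e0; have [y yF] := near_c e e0; exists y; split=> // n.
  have nc : (fun x : c0 => `|y n - x n|) @ F --> `|y n - l n|.
    by apply: cvg_norm; apply: cvgB; [exact: cvg_cst|exact: coord].
  apply: (cvgr_to_le nc); near=> x.
  by apply: le_trans (dist_le y x n) _; near: x.
have l0 : l @ \oo --> (0 : R).
  apply/cvgrPdist_le => e e0; have e20 := divr_gt0 e0 (ltr0n R 2).
  have [y [yl _]] := l_close _ e20.
  have /cvgrPdist_le/(_ _ e20) y0 := c0_cvg y.
  near=> n; rewrite (_ : 0 - l n = (0 - y n) + (y n - l n)); last first.
    by rewrite addrA subrK.
  rewrite (splitr e) (le_trans (ler_normD _ _))// lerD//.
  by near: n.
have l_in : l \in c0_pred by apply/asboolP.
apply/cvg_ex; exists (C0 l_in); apply/cvgrPdist_le => e e0.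
have [y [yl yF]] := l_close _ (divr_gt0 e0 (ltr0n R 2)).
near=> x; rewrite (_ : C0 l_in - x = (C0 l_in - y) + (y - x)); last first.
  by rewrite addrA subrK.
rewrite (splitr e) (le_trans (ler_normD _ _))// lerD//; last by near: x.
by apply: c0_norm_le => n; rewrite distrC; exact: yl.
Unshelve. all: by end_near. Qed.

HB.instance Definition _ := Uniform_isComplete.Build c0 c0_complete.

End C0.

(* The space L(E, F) of continuous linear maps with the operator norm. *)
Section ContinuousLinear.
Variables (R : realType) (E F : normedModType R).

Definition clin_pred : {pred E -> F} :=
  fun f => `[< linear f /\ continuous f >].

Record clin := CLin { clin_val :> E -> F ; clin_valP : clin_val \in clin_pred }.

HB.instance Definition _ := [isSub for clin_val].
HB.instance Definition _ := [Choice of clin by <:].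

Lemma clin_linear (f : clin) : linear f.
Proof. by have [] := asboolW (clin_valP f). Qed.

Lemma clin_continuous (f : clin) : continuous f.
Proof. by have [] := asboolW (clin_valP f). Qed.

HB.instance Definition _ (f : clin) :=
  GRing.isLinear.Build R E F _ f (clin_linear f).

Lemma clin_submod_closed : submod_closed clin_pred.
Proof.
split=> [|a f g].
  apply/asboolP; split; last exact: cst_continuous.
  by move=> a x y; rewrite /= scaler0 addr0.
move=> /asboolP[fl fc] /asboolP[gl gc]; apply/asboolP; split=> [b x y|x].
  rewrite !fctE fl gl !scalerDr !scalerA (mulrC a b) -!addrA; congr +%R.
  by rewrite [RHS]addrCA.
by apply: cvgD; [apply: cvgZr; exact: fc|exact: gc].
Qed.

HB.instance Definition _ :=
  GRing.SubChoice_isSubLmodule.Build R (E -> F) clin_pred clin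
    (GRing.submod_closed_semi clin_submod_closed).

Definition op_norm (f : clin) : R :=
  sup [set `|f x| | x in [set x : E | `|x| <= 1]].

Lemma op_norm_has_sup (f : clin) :
  has_sup [set `|f x| | x in [set x : E | `|x| <= 1]].
Proof.
split; first by exists `|f 0|, 0 => //=; rewrite normr0.
have /linear_bounded_continuous/bounded_funP/(_ 1)[M fM] := clin_continuous (f := f).
by exists M => _ [x x1 <-]; exact: fM.
Qed.

Lemma le_op_norm (f : clin) x : `|f x| <= op_norm f * `|x|.
Proof.
have [->|x0] := eqVneq x 0; first by rewrite linear0 !normr0 mulr0.
have nx0 : 0 < `|x| by rewrite normr_gt0.
rewrite -ler_pdivrMr//; apply: ub_le_sup; first by case: (op_norm_has_sup f).
exists (`|x|^-1 *: x) => /=; first by rewrite normrZ normfV normr_id mulVf ?normr_eq0.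
by rewrite linearZ/= normrZ normfV normr_id mulrC.
Qed.

Lemma op_norm_ge0 (f : clin) : 0 <= op_norm f.
Proof.
apply: (@le_trans _ _ `|f 0|) => //; apply: ub_le_sup.
  by case: (op_norm_has_sup f).
by exists 0 => //=; rewrite normr0.
Qed.

Lemma op_norm_le (f : clin) M :
  0 <= M -> (forall x, `|f x| <= M * `|x|) -> op_norm f <= M.
Proof.
move=> M0 fM; apply: ge_sup; first by case: (op_norm_has_sup f).
by move=> _ [x /= x1 <-]; apply: le_trans (fM x) _; rewrite ler_piMr.
Qed.

Lemma op_normD (f g : clin) : op_norm (f + g) <= op_norm f + op_norm g.
Proof.
apply: op_norm_le => [|x]; first by rewrite addr_ge0 ?op_norm_ge0.
by rewrite mulrDl (le_trans (ler_normD _ _))// lerD ?le_op_norm.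
Qed.

Lemma op_normZ (a : R) (f : clin) : op_norm (a *: f) = `|a| * op_norm f.
Proof.
have le_Z b g : op_norm (b *: g) <= `|b| * op_norm g.
  apply: op_norm_le => [|x]; first by rewrite mulr_ge0 ?op_norm_ge0.
  have -> : (b *: g) x = b *: g x by [].
  by rewrite normrZ -mulrA ler_wpM2l// le_op_norm.
apply/eqP; rewrite eq_le le_Z/=.
have [->|a0] := eqVneq a 0; first by rewrite normr0 mul0r op_norm_ge0.
rewrite -ler_pdivlMl ?normr_gt0// -normfV.
by rewrite -{1}(scale1r f) -(mulVf a0) -scalerA le_Z.
Qed.

Lemma op_norm0_eq0 (f : clin) : op_norm f = 0 -> f = 0.
Proof.
move=> f0; apply/val_inj/funext => x; apply/eqP.
by rewrite -normr_le0 (le_trans (le_op_norm f x))// f0 mul0r.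
Qed.

HB.instance Definition _ :=
  Lmodule_isNormed.Build R clin op_normD op_normZ op_norm0_eq0.

Lemma op_normE (f : clin) :
  `|f| = sup [set `|f x| | x in [set x : E | `|x| <= 1]].
Proof. by []. Qed.

End ContinuousLinear.

(* [Ck_on k U f] is meant for open U: f is k times continuously Frechet
   differentiable on U, the j-th derivative being a map into the j-fold
   iterated operator space L(E, L(E, ... L(E, F))). *)
Fixpoint Ck_on (R : realType) (E : normedModType R) (k : nat) (U : set E)
    (F : normedModType R) (f : E -> F) {struct k} : Prop :=
  match k with
  | 0 => forall x, U x -> {for x, continuous f}
  | k'.+1 => exists Df : E -> clin E F,
      (forall x, U x -> is_diff x f (Df x)) /\ Ck_on k' U Df
  end.

Section Norms.
Variables (R : realType) (E : normedModType R).

Definition is_norm (N : E -> R) : Prop :=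
  [/\ forall x y, N (x + y) <= N x + N y,
      forall (a : R) x, N (a *: x) = `|a| * N x
    & forall x, N x = 0 -> x = 0].

Definition equivalent_norm (N : E -> R) : Prop :=
  is_norm N /\
  exists a b : R, [/\ 0 < a, 0 < b & forall x, a * `|x| <= N x <= b * `|x|].

Definition smooth_norm (N : E -> R) : Prop :=
  forall k, Ck_on k [set x : E | x != 0] N.

(* The topological dual of E is [clin E R]; it is the same for every equivalent
   norm.  The supremum is finite as soon as N is equivalent to the norm of E. *)
Definition dual_norm (N : E -> R) (f : clin E R) : R :=
  sup [set `|f x| | x in [set x : E | N x <= 1]].

End Norms.

Definition strictly_convex (R : realType) (V : lmodType R) (p : V -> R) : Prop :=
  forall x y : V, p x <= 1 -> p y <= 1 -> x <> y -> p (2^-1 *: (x + y)) < 1.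

(* Main.v *)
From HB Require Import structures.
Require Import Defs.
From mathcomp Require Import all_boot all_order all_algebra.
From mathcomp Require Import ring lra.
From mathcomp Require Import all_classical all_reals all_analysis.
Import Order.TTheory GRing.Theory Num.Theory.
Import numFieldNormedType.Exports.
Local Open Scope classical_set_scope.
Local Open Scope ring_scope.

Set Implicit Arguments.
Unset Strict Implicit.
Unset Printing Implicit Defensive.

(** If a norm [N] is differentiable and a segment [[g, h]] lies on its dual
unit sphere, then the midpoint of the segment cannot attain its norm: at a point
where it did, the derivative of [N] would be both [g] and [h]. The construction
therefore starts from functionals that do not attain their norm, and hides a
corner of the unit ball at the place where they would.

A functional on c_0 with positive weights of sum 1 is less than 1 everywhere on
the unit ball of the sup norm, while it tends to 1 along (1,...,1,0,0,...)
([geometric_functional], [geometric_functional_lt]). Take two such functionals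
[u] and [v], different from each other, and put [t = (u + v) / 2] and
[s = (u - v) / 2]. The pair [(s, t)] maps the ball into the square
[|t| + |s| <= 1]; the vertices [(0, 1)] and [(0, -1)] are limits of images but
not images. The planar set [|s| <= 1 - t^2] contains this square, has corners at
exactly these two vertices, and is the sublevel set at 1 of the convex function
[lens s t = t^2 + s^2 / (1 - t^2)], which is smooth on the strip [|t| < 1].

Let [phi] be an even convex smooth function that vanishes on [[-1, 1]] and
exceeds 1 outside [[-1 - eps, 1 + eps]] ([barrier]), let [F x] be the sum of the
[phi (x_n)] plus [lens (s x) (t x)], and let [N] be the gauge of the body [B]
of the points where [|t x| < 1] and [F x <= 1].

- The unit ball of the sup norm lies in [B], and [B] lies in its multiple by
  [1 + eps]; this gives both inequalities between [N] and the sup norm.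
- [B] contains its limits along rays, although the strip is open
  ([body_radial]): at a limit [z] with [|t z| >= 1] every [phi (z_n)] would
  vanish, so that [z] would be in the unit ball, where [|t| < 1].
- The sum of the [phi (x_n)] is locally finite, so [F] is smooth on the strip.
  With [z = x / N x] one has [F z = 1], and convexity gives [F'(z) z >= 1];
  hence [N'(x) = F'(z) / F'(z) z], and this formula raises the regularity of [N]
  by one order at a time ([smooth_implicit]).
- The lens lies in [|t| + |s| / 2 <= 1], so [t + s / 2] and [t - s / 2] have
  dual norm at most 1. Their midpoint [t] has dual norm 1, since [t] tends to 1
  along (1,...,1,0,0,...). *)

(** * Bounded linear and bilinear maps *)

Section BoundedMaps.
Variable R : realType.
Implicit Types E F G H : normedModType R.

Lemma clin_ext E F (L K : clin E F) : L =1 K -> L = K.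
Proof. by move=> LK; apply/val_inj/funext. Qed.

Lemma clinDE E F (L K : clin E F) x : (L + K) x = L x + K x.
Proof. by []. Qed.

Lemma clinZE E F k (L : clin E F) x : (k *: L) x = k *: L x.
Proof. by []. Qed.

Lemma clin_exists E F (g : E -> F) (M : R) : linear g ->
  (forall x, `|g x| <= M * `|x|) -> exists L : clin E F, L =1 g.
Proof.
move=> lg gM.
suff gc : g \in @clin_pred R E F by exists (CLin gc).
apply/asboolP; split=> //.
pose gL : {linear _ -> _} := HB.pack g (GRing.isLinear.Build _ _ _ _ _ lg).
rewrite -[g]/(gL : _ -> _); apply/linear_bounded_continuous/linear_boundedP.
exists M; split=> [|r Mr x]; first exact: num_real.
by apply: le_trans (gM x) _; apply: ler_wpM2r => //; exact: ltW.
Qed.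

Definition bounded_bilinear F G H (B : F -> G -> H) :=
  [/\ forall a, linear (B a), forall b, linear (B ^~ b)
    & exists2 M : R, 0 <= M & forall a b, `|B a b| <= M * `|a| * `|b|].

Section Bilinear.
Variables (F G H : normedModType R) (B : F -> G -> H).
Hypothesis BB : bounded_bilinear B.

Lemma bilinBr a b b' : B a (b - b') = B a b - B a b'.
Proof.
by have [/(_ a) l _ _] := BB; rewrite addrC -scaleN1r l scaleN1r addrC.
Qed.

Lemma bilinBl a a' b : B (a - a') b = B a b - B a' b.
Proof.
by have [_ /(_ b) l _] := BB; rewrite addrC -scaleN1r l scaleN1r addrC.
Qed.

Lemma curry_bilinear : exists L : clin F (clin G H), forall a b, L a b = B a b.
Proof.
have [Br Bl [M M0 BM]] := BB.
have /choice[L LE] : forall a, exists L : clin G H, L =1 B a.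
  by move=> a; apply: clin_exists (BM a).
have /clin_exists : linear L.
  by move=> k a a'; apply: clin_ext => b; rewrite clinDE clinZE !LE Bl.
move=> /(_ M)[a|L' L'E]; last by exists L' => a b; rewrite L'E LE.
by apply: op_norm_le => [|b]; rewrite ?mulr_ge0// LE.
Qed.

(** Composing one argument of [B] with an operator produces the two summands of
the derivative of [x |-> B (f x) (g x)]. They are bounded bilinear again, which
is what lets the product rule be iterated. *)
Lemma bilin_clin_r E : exists2 B1 : F -> clin E G -> clin E H,
  bounded_bilinear B1 & forall a L x, B1 a L x = B a (L x).
Proof.
have [Br Bl [M M0 BM]] := BB.
have bd a (L : clin E G) x : `|B a (L x)| <= (M * `|a| * `|L|) * `|x|.
  apply: le_trans (BM _ _) _; rewrite -[leRHS]mulrA ler_wpM2l ?mulr_ge0//.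
  exact: le_op_norm.
have /choice[B1 B1E] : forall aL : F * clin E G,
    exists L : clin E H, forall x, L x = B aL.1 (aL.2 x).
  move=> [a L] /=; apply: clin_exists (bd a L) => k x y /=.
  by rewrite linearP Br.
exists (fun a L => B1 (a, L)) => [|a L x]; last by rewrite B1E.
split=> [a k L L'|L k a a'|].
- by apply: clin_ext => x; rewrite clinDE clinZE !B1E /= Br.
- by apply: clin_ext => x; rewrite clinDE clinZE !B1E /= Bl.
- exists M => // a L.
  by apply: op_norm_le => [|x]; rewrite ?mulr_ge0// B1E; exact: bd.
Qed.

Lemma bounded_bilinear_flip : bounded_bilinear (fun b a => B a b).
Proof.
have [Br Bl [M M0 BM]] := BB; split=> //.
by exists M => // b a; rewrite mulrAC.
Qed.

End Bilinear.

Lemma bilin_clin_l E F G H (B : F -> G -> H) : bounded_bilinear B ->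
  exists2 B2 : clin E F -> G -> clin E H,
  bounded_bilinear B2 & forall L b x, B2 L b x = B (L x) b.
Proof.
move=> /bounded_bilinear_flip/(@bilin_clin_r _ _ _ _)/(_ E)[B1 B1B B1E].
by exists (fun L b => B1 b L) => //; exact: bounded_bilinear_flip.
Qed.

Lemma eval_bilinear F G : bounded_bilinear (fun (L : clin F G) x => L x).
Proof.
split=> [L|b|]; first exact: clin_linear; first by move=> k L K; rewrite clinDE.
by exists 1 => // L x; rewrite mul1r; exact: le_op_norm.
Qed.

Lemma comp_bilinear E F G : exists2 B : clin F G -> clin E F -> clin E G,
  bounded_bilinear B & forall L K x, B L K x = L (K x).
Proof. exact/bilin_clin_r/eval_bilinear. Qed.

Lemma scale_bilinear F : bounded_bilinear (fun (a : R) (x : F) => a *: x).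
Proof.
split=> [a k x y|b k x y|].
- by rewrite scalerDr !scalerA mulrC.
- by rewrite scalerDl scalerA.
- by exists 1 => // a b; rewrite mul1r normrZ.
Qed.

Lemma scalar_clin_exists : exists m : clin R (clin R R), forall a h, m a h = h * a.
Proof.
have [L LE] := curry_bilinear (scale_bilinear R).
by exists L => a h; rewrite LE mulrC.
Qed.

End BoundedMaps.

(** * Frechet differentials *)

Section Frechet.
Variable R : realType.
Implicit Types E F G H : normedModType R.

(** Products and implicit functions are estimated with this explicit form of the
remainder. *)
Lemma is_diff_epsP E F (f : E -> F) (x : E) (L : clin E F) :
  is_diff x f L <->
  forall e : R, 0 < e -> \forall y \near x,
     `|f y - f x - L (y - x)| <= e * `|y - x|.
Proof.
have shiftP (K : E -> F) : (f \o shift x = cst (f x) + K +o_ 0 id) <->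
    forall e : R, 0 < e ->
      \forall y \near x, `|f y - f x - K (y - x)| <= e * `|y - x|.
  rewrite eqaddoP; split=> H e /H{H}.
    move=> H; apply/nbhs0P; apply: filterS H => y.
    by rewrite /= [x + y]addrC addrK opprD addrA.
  move=> /nbhs0P; apply: filterS => y.
  by rewrite /= [x + y]addrC addrK opprD addrA.
split=> [[/diff_locally fx Lx]|/shiftP fL]; first by apply/shiftP; rewrite -Lx.
have Lc : continuous L := clin_continuous (f := L).
have dfL : 'd f x = L :> (E -> F) by apply: diff_unique.
by split=> //; apply/diff_locallyP; split; rewrite dfL.
Qed.

Lemma is_diff_unique E F (f : E -> F) (x : E) (L K : clin E F) :
  is_diff x f L -> is_diff x f K -> L = K.
Proof. by move=> [_ fL] [_ fK]; apply: val_inj; rewrite /= -fL -fK. Qed.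

Lemma is_diff_cont E F (f : E -> F) x (L : clin E F) :
  is_diff x f L -> {for x, continuous f}.
Proof. by case=> fx _; exact: differentiable_continuous. Qed.

Lemma is_diff_near E F (f g : E -> F) (x : E) (L : clin E F) :
  (\forall y \near x, f y = g y) -> is_diff x f L -> is_diff x g L.
Proof.
move=> fg /is_diff_epsP fL; apply/is_diff_epsP => e /fL{}fL.
have fgx : f x = g x := nbhs_singleton fg.
by apply: filterS2 fg fL => y <-; rewrite fgx.
Qed.

(** The algebra of the product rule, with [a = B (f y) (g y)],
[b = B (f x) (g x)], [p = B (f x) (g y)], [q = B (Lf h) (g y)] and the two terms
[c], [d] of the differential at [h = y - x]: each of the three groups on the
right is of order [o(h)]. *)
Lemma bilinear_increment (V : zmodType) (a b c d p q : V) :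
  a - b - (c + d) = a - p - q + (q - d) + (p - b - c).
Proof.
rewrite [a - p - q + _]addrA subrK [a - p - d]addrAC -(addrA p).
by rewrite [a - d - p + _]addrA subrK opprD [RHS]addrAC !addrA.
Qed.

Lemma is_diff_bilinear E F G H (B : F -> G -> H) (f : E -> F) (g : E -> G) x
   (Lf : clin E F) (Lg : clin E G) (K : clin E H) :
  bounded_bilinear B -> is_diff x f Lf -> is_diff x g Lg ->
  (forall h, K h = B (f x) (Lg h) + B (Lf h) (g x)) ->
  is_diff x (fun y => B (f y) (g y)) K.
Proof.
move=> BB df dg KE; have [_ _ [M M0 BM]] := BB.
have gc : {for x, continuous g} by apply: differentiable_continuous; case: dg.
have near_dist r : 0 < r -> \forall y \near x, `|g y - g x| <= r.
  by move=> r0; near=> y; rewrite distrC; near: y; exact: cvgr_dist_le.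
move/is_diff_epsP: df => df; move/is_diff_epsP: dg => dg.
apply/is_diff_epsP => e e0.
pose C := M * (`|g x| + 1 + `|Lf| + `|f x|) + 1.
have C0 : 0 < C by rewrite ltr_wpDl// mulr_ge0// !addr_ge0.
have d0 : 0 < e / C by rewrite divr_gt0.
near=> y.
have -> : B (f y) (g y) - B (f x) (g x) - K (y - x) =
   B (f y - f x - Lf (y - x)) (g y) + B (Lf (y - x)) (g y - g x)
   + B (f x) (g y - g x - Lg (y - x)).
  rewrite KE !(bilinBl BB) !(bilinBr BB).
  set a := B (f y) (g y). set b := B (f x) (g x).
  set c := B (f x) (Lg _). set d := B (Lf _) (g x).
  set p := B (f x) (g y). set q := B (Lf _) (g y).
  exact: bilinear_increment.
apply: le_trans (ler_normD _ _) _.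
apply: le_trans (lerD (ler_normD _ _) (lexx _)) _.
have h0 := normr_ge0 (y - x).
have gy : `|g y - g x| <= 1 by near: y; exact: near_dist.
have gy1 : `|g y - g x| <= e / C by near: y; exact: near_dist.
have gyx : `|g y| <= `|g x| + 1.
  by rewrite -(subrK (g x) (g y)) addrC (le_trans (ler_normD _ _))// lerD2l.
have H1 : `|B (f y - f x - Lf (y - x)) (g y)| <=
    M * ((e / C) * `|y - x|) * (`|g x| + 1).
  apply: le_trans (BM _ _) _; apply: ler_pM => //; first by rewrite mulr_ge0.
  by apply: ler_wpM2l => //; near: y; exact: df.
have H2 : `|B (Lf (y - x)) (g y - g x)| <=
    M * (`|Lf| * `|y - x|) * (e / C).
  apply: le_trans (BM _ _) _; apply: ler_pM => //; first by rewrite mulr_ge0.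
  by apply: ler_wpM2l => //; exact: le_op_norm.
have H3 : `|B (f x) (g y - g x - Lg (y - x))| <=
    M * `|f x| * ((e / C) * `|y - x|).
  apply: le_trans (BM _ _) _; apply: ler_pM => //; first by rewrite mulr_ge0.
  by near: y; exact: dg.
apply: le_trans (lerD (lerD H1 H2) H3) _.
rewrite [leLHS](_ : _ =
  (M * (`|g x| + 1 + `|Lf| + `|f x|)) * (e / C) * `|y - x|); last by ring.
apply: ler_wpM2r => //.
by rewrite mulrA ler_pdivrMr// mulrC ler_wpM2l ?(ltW e0)// lerDl.
Unshelve. all: by end_near. Qed.

Lemma is_diff_real (f : R -> R) (x d : R) (L : clin R R) :
  is_derive x 1 f d -> (forall h, L h = h * d) -> is_diff x f L.
Proof.
move=> [fx fd] LE; have fdf : differentiable f x by apply/derivable1_diffP.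
by split=> //; rewrite diff1E//; apply/funext => h; rewrite LE derive1E fd.
Qed.

End Frechet.

(** * Calculus of maps of class C^k *)

Section CkRules.
Variable R : realType.
Implicit Types E F G H : normedModType R.

Lemma Ck_pred k E F (U : set E) (f : E -> F) : Ck_on k.+1 U f -> Ck_on k U f.
Proof.
elim: k F f => [|k IH] F f [Df [fD CD]].
  by move=> x /fD/is_diff_cont.
by exists Df; split=> //; exact: IH.
Qed.

Lemma Ck_cst k E F (U : set E) (a : F) : Ck_on k U (cst a).
Proof.
elim: k F a => [|k IH] F a /=; first by move=> x _; exact: cst_continuous.
by exists (cst 0); split=> // x _; exact: is_diff_cst.
Qed.

Lemma Ck_clin k E F (U : set E) (L : clin E F) : Ck_on k U L.
Proof.
case: k => [|k] /=; first by move=> x _; exact: clin_continuous.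
exists (cst L); split; last exact: Ck_cst.
by move=> x _; split; [apply: linear_differentiable|apply: diff_lin];
  exact: clin_continuous.
Qed.

Lemma Ck_id k E (U : set E) : Ck_on k U (fun x => x).
Proof.
have [|x|L LE] := @clin_exists R E E idfun 1; [by []|by rewrite mul1r|].
by rewrite -(_ : L = id :> (E -> E)); [exact: Ck_clin|exact/funext].
Qed.

Lemma CkD k E F (U : set E) (f g : E -> F) :
  Ck_on k U f -> Ck_on k U g -> Ck_on k U (fun x => f x + g x).
Proof.
elim: k F f g => [|k IH] F f g /=.
  by move=> fU gU x Ux; apply: cvgD; [exact: fU|exact: gU].
move=> [Df [fD CDf]] [Dg [gD CDg]].
exists (fun x => Df x + Dg x); split; last exact: IH.
move=> x Ux; have df := fD x Ux; have dg := gD x Ux.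
exact: (@is_diffD _ _ _ f g (Df x) (Dg x) x).
Qed.

(** Induction on [k] for all bilinear maps together: the derivative is a sum of
two expressions of the same kind in [f], [g] and their derivatives. *)
Lemma Ck_bilinear k E F G H (B : F -> G -> H) (U : set E)
    (f : E -> F) (g : E -> G) :
  bounded_bilinear B -> Ck_on k U f -> Ck_on k U g ->
  Ck_on k U (fun x => B (f x) (g x)).
Proof.
elim: k F G H B f g => [|k IH] F G H B f g BB.
  move=> fU gU x Ux; have fc := fU x Ux; have gc := gU x Ux.
  have [_ _ [M M0 BM]] := BB.
  have f0 : `|f y - f x| @[y --> x] --> (0 : R).
    rewrite -(normr0 F) -(subrr (f x)).
    by apply: cvg_norm; apply: cvgB (cvg_cst _).
  have g0 : `|g y - g x| @[y --> x] --> (0 : R).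
    rewrite -(normr0 G) -(subrr (g x)).
    by apply: cvg_norm; apply: cvgB (cvg_cst _).
  have bd : M * `|f y - f x| * `|g y| + M * `|f x| * `|g y - g x| @[y --> x]
      --> (0 : R).
    rewrite (_ : 0 = M * 0 * `|g x| + M * `|f x| * 0); last first.
      by rewrite !(mulr0, mul0r) addr0.
    apply: cvgD; apply: cvgM => //; first by apply: cvgM => //; exact: cvg_cst.
      exact: cvg_norm.
    exact: cvg_cst.
  apply/cvgrPdist_le => e e0; near=> y.
  rewrite distrC.
  have -> : B (f y) (g y) - B (f x) (g x) =
      B (f y - f x) (g y) + B (f x) (g y - g x).
    by rewrite (bilinBl BB) (bilinBr BB) addrA subrK.
  apply: le_trans (ler_normD _ _) _; apply: le_trans (lerD (BM _ _) (BM _ _)) _.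
  apply: le_trans (ler_norm _) _; near: y.
  by have /cvgrPdist_le/(_ _ e0) := bd; apply: filterS => y; rewrite sub0r normrN.
move=> fU gU; have fk := Ck_pred fU; have gk := Ck_pred gU.
case: fU => Df [fD CDf]; case: gU => Dg [gD CDg].
have [B1 B1B B1E] := bilin_clin_r BB E.
have [B2 B2B B2E] := bilin_clin_l E BB.
exists (fun x => B1 (f x) (Dg x) + B2 (Df x) (g x)); split.
  move=> x Ux; apply: is_diff_bilinear BB (fD x Ux) (gD x Ux) _ => h.
  by rewrite clinDE B1E B2E.
by apply: CkD; exact: IH.
Unshelve. all: by end_near. Qed.

(** By the chain rule the derivative is bilinear in [g' \o f] and [f'], so the
induction step is an instance of the product rule. *)
Lemma Ck_comp k E F G (U : set E) (V : set F) (f : E -> F) (g : F -> G) :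
  (forall x, U x -> V (f x)) ->
  Ck_on k U f -> Ck_on k V g -> Ck_on k U (g \o f).
Proof.
elim: k F G V f g => [|k IH] F G V f g UV.
  by move=> fU gV x Ux; apply: continuous_comp; [exact: fU|exact/gV/UV].
move=> fU; have fk := Ck_pred fU; case: fU => Df [fD CDf] [Dg [gD CDg]].
have [B BB BE] := @comp_bilinear R E F G.
exists (fun x => B (Dg (f x)) (Df x)); split.
  move=> x Ux; have dg := gD _ (UV _ Ux); have df := fD _ Ux.
  have -> : B (Dg (f x)) (Df x) = Dg (f x) \o Df x :> (E -> G).
    by apply/funext => h; rewrite BE.
  exact: is_diff_comp.
by apply: Ck_bilinear BB _ CDf; exact: IH CDg.
Qed.

(** Derivatives are unique, so those of the local models agree with one globally
chosen derivative of [f]. *)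
Lemma Ck_local k E F (U : set E) (f : E -> F) :
  (forall x, U x -> exists (W : set E) (g : E -> F),
    [/\ open W, W x, forall y, W y -> f y = g y & Ck_on k W g]) ->
  Ck_on k U f.
Proof.
elim: k F f => [|k IH] F f loc /=.
  move=> x /loc[W [g [oW Wx fg Cg]]]; rewrite /prop_for /continuous_at fg//.
  apply: cvg_trans (Cg x Wx); apply: near_eq_cvg.
  by have := open_nbhs_nbhs (conj oW Wx); apply: filterS => z /fg ->.
(* where [f] is not differentiable the chosen value is 0 *)
have /choice[Df DfE] : forall x, exists L : clin E F,
    forall K : clin E F, is_diff x f K -> L = K.
  move=> x; have [[L fL]|nL] := pselect (exists L : clin E F, is_diff x f L).
    by exists L => K; exact: is_diff_unique.
  by exists 0 => K fK; case: nL; exists K.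
have fW W (g : E -> F) (Dg : E -> clin E F) : open W ->
    (forall y, W y -> f y = g y) -> (forall y, W y -> is_diff y g (Dg y)) ->
    forall y, W y -> is_diff y f (Dg y).
  move=> oW fg gD y Wy; apply: is_diff_near (gD y Wy).
  by have := open_nbhs_nbhs (conj oW Wy); apply: filterS => z /fg.
exists Df; split=> [x /loc[W [g [oW Wx fg [Dg [gD _]]]]]|].
  by have df := fW _ _ _ oW fg gD x Wx; rewrite (DfE _ _ df).
apply: IH => x /loc[W [g [oW Wx fg [Dg [gD CDg]]]]].
exists W, Dg; split=> // y Wy.
exact/DfE/(fW _ _ _ oW fg gD y Wy).
Qed.

Lemma CkZ k E F (U : set E) (f : E -> R) (g : E -> F) :
  Ck_on k U f -> Ck_on k U g -> Ck_on k U (fun x => f x *: g x).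
Proof. exact: (Ck_bilinear (@scale_bilinear R F)). Qed.

Lemma CkM k E (U : set E) (f g : E -> R) :
  Ck_on k U f -> Ck_on k U g -> Ck_on k U (fun x => f x * g x).
Proof. exact: CkZ. Qed.

Lemma Ck_sum k E F (U : set E) n (f : nat -> E -> F) :
  (forall i, Ck_on k U (f i)) -> Ck_on k U (fun x => \sum_(i < n) f i x).
Proof.
move=> fU; elim: n => [|n IH].
  under eq_fun do rewrite big_ord0; exact: Ck_cst.
under eq_fun do rewrite big_ord_recr; exact: CkD.
Qed.

Lemma Ck_real k (U : set R) (f df : R -> R) :
  (forall x, U x -> is_derive x 1 f (df x)) -> Ck_on k U df -> Ck_on k.+1 U f.
Proof.
move=> fD Cdf; have [m mE] := scalar_clin_exists R.
exists (m \o df); split=> [x /fD|]; first by move=> /is_diff_real; apply=> h /=.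
by apply: (Ck_comp (V := setT)) => //; exact: Ck_clin.
Qed.

Lemma Ck_inv k : Ck_on k [set r : R | r != 0] (fun r => r^-1).
Proof.
elim: k => [|k IH]; first by move=> r /= r0; exact: inv_continuous.
apply: (@Ck_real _ _ _ (fun r => - 1 * (r^-1 * r^-1))); last first.
  by apply: CkM; [exact: Ck_cst|exact: CkM].
move=> r r0.
have := @is_deriveV _ id r 1 1 r0 (is_derive_id _ _).
by rewrite /GRing.scale /= mulr1 mulN1r -invfM -expr2.
Qed.

Lemma CkV k E (U : set E) (f : E -> R) : (forall x, U x -> f x != 0) ->
  Ck_on k U f -> Ck_on k U (fun x => (f x)^-1).
Proof. by move=> f0 fU; apply: (Ck_comp f0 fU); exact: Ck_inv. Qed.

End CkRules.

(** * Smoothness of an implicitly defined norm *)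

Section ImplicitNorm.
Variables (R : realType) (E : normedModType R) (N F : E -> R) (V : set E) (b : R).
Hypothesis b0 : 0 <= b.
Hypothesis Nlip : forall x y, `|N x - N y| <= b * `|x - y|.
Hypothesis Npos : forall x, x != 0 -> 0 < N x.
Hypothesis NV : forall x, x != 0 -> V ((N x)^-1 *: x).
Hypothesis FN : forall x, x != 0 -> F ((N x)^-1 *: x) = 1.
Hypothesis FV : forall k, Ck_on k V F.
Hypothesis dF_radial : forall z (L : clin E R),
  V z -> F z = 1 -> is_diff z F L -> L z != 0.

Let U := [set x : E | x != 0].

Lemma lip_continuous : Ck_on 0 U N.
Proof.
move=> x _; apply/cvgrPdist_le => e e0; near=> y.
apply: le_trans (Nlip _ _) _.
apply: (@le_trans _ _ ((b + 1) * `|x - y|)).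
  by rewrite ler_wpM2r// lerDl.
rewrite mulrC -ler_pdivlMr ?ltr_wpDl//.
near: y; apply: cvgr_dist_le; first exact: cvg_id.
by rewrite divr_gt0 ?ltr_wpDl.
Unshelve. all: by end_near. Qed.

Lemma Ck_normalize k : Ck_on k U N -> Ck_on k U (fun x => (N x)^-1 *: x).
Proof.
move=> Nk; apply: CkZ; first by apply: CkV => // x /Npos; rewrite lt0r => /andP[].
exact: Ck_id.
Qed.

(** Put [z = x / N x], [v = y / N y] and [h = y - x]. From [F v = F z = 1] comes
[L (v - z) = o(v - z)], while [N y (v - z) = h - (N y - N x) z], which is [O(h)]
because [N] is Lipschitz. Applying [L] and solving for [N y - N x] gives
[L h / L z + o(h)]. *)
Lemma is_diff_implicit x (L K : clin E R) : x != 0 ->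
  is_diff ((N x)^-1 *: x) F L ->
  (forall h, K h = (L ((N x)^-1 *: x))^-1 * L h) -> is_diff x N K.
Proof.
move=> x0; set z := _ *: x => FL KE.
have Lz := dF_radial (NV x0) (FN x0) FL.
have zc : {for x, continuous (fun y => (N y)^-1 *: y)}.
  by have := Ck_normalize lip_continuous; exact.
move/is_diff_epsP: FL => FL.
apply/is_diff_epsP => e e0.
pose C := 1 + b * `|z|.
have C0 : 0 < C by rewrite ltr_wpDr// mulr_ge0.
have Lz0 : 0 < `|L z| by rewrite normr_gt0.
have d0 : 0 < e * `|L z| / C by rewrite divr_gt0// mulr_gt0.
pose w y := (N y)^-1 *: y.
have {FL} FL : \forall y \near x,
  `|F (w y) - F z - L (w y - z)| <= e * `|L z| / C * `|w y - z|.
  exact: zc (FL _ d0).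
near=> y; set h := y - x.
have y0 : y != 0 by near: y; apply: (cvgr_neq0 x).
have Ny := Npos y0.
have FLy : `|F (w y) - F z - L (w y - z)| <= e * `|L z| / C * `|w y - z|.
  by near: y.
move: FLy; have : w y = (N y)^-1 *: y by []; move: (w y) => v wE {}FLy.
have Lv : `|L (v - z)| <= e * `|L z| / C * `|v - z|.
  by move: FLy; rewrite wE !FN// subrr sub0r normrN.
have yE : y = N y *: v by rewrite wE scalerA mulfV ?scale1r// gt_eqF.
have xE : x = N x *: z by rewrite scalerA mulfV ?scale1r// gt_eqF// Npos.
have LE : N y * L (v - z) = L h - (N y - N x) * L z.
  have Ly : L y = N y * L v by rewrite {1}yE linearZ.
  have Lx : L x = N x * L z by rewrite {1}xE linearZ.
  rewrite /h !linearB /= Ly Lx; ring.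
have wz : N y * `|v - z| <= C * `|h|.
  rewrite -(gtr0_norm Ny) -normrZ.
  have -> : N y *: (v - z) = h - (N y - N x) *: z.
    by rewrite /h scalerBr -yE scalerBl -xE opprB addrA subrK.
  apply: le_trans (ler_normB _ _) _; rewrite normrZ mulrDl mul1r lerD2l.
  by rewrite mulrAC ler_wpM2r//; exact: Nlip.
have -> : N y - N x - K h = - (L z)^-1 * (N y * L (v - z)).
  by rewrite LE KE; field.
rewrite normrM normrN normfV ler_pdivrMl// normrM (gtr0_norm Ny).
apply: (@le_trans _ _ (N y * (e * `|L z| / C * `|v - z|))).
  by rewrite ler_wpM2l// ltW.
have -> : N y * (e * `|L z| / C * `|v - z|) =
    e * `|L z| / C * (N y * `|v - z|) by ring.
apply: le_trans (ler_wpM2l (ltW d0) wz) _.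
by rewrite mulrA divfK ?gt_eqF// -mulrA mulrCA.
Unshelve. all: by end_near. Qed.

(** The derivative of [N] at [x] is a smooth expression in [x / N x] alone, so it
is as regular as [N], and [N] is then once more differentiable. *)
Lemma smooth_implicit : smooth_norm N.
Proof.
elim=> [|k Nk]; first exact: lip_continuous.
have [DF [FD CDF]] := FV k.+1.
pose z x := (N x)^-1 *: x.
have zk : Ck_on k U z := Ck_normalize Nk.
have DFz : Ck_on k U (fun x => DF (z x)) by apply: Ck_comp zk CDF => x; exact: NV.
exists (fun x => (DF (z x) (z x))^-1 *: DF (z x)); split.
  move=> x x0; apply: is_diff_implicit (FD _ (NV x0)) _ => // h.
apply: CkZ => //; apply: CkV.
  by move=> x x0; apply: (dF_radial (NV x0) (FN x0)); exact/FD/NV.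
exact: (Ck_bilinear (@eval_bilinear R E R)).
Qed.

End ImplicitNorm.

(** * A flat convex function on the line *)

Section Flat.
Variable R : realType.

(** The family is stable under differentiation up to linear combinations, so one
induction on the order of differentiability treats all of it. *)
Definition flat j (x : R) : R := if 0 < x then x^-1 ^+ j * expR (- x^-1) else 0.

Lemma flat_ge0 j x : 0 <= flat j x.
Proof.
rewrite /flat; case: ltP => // x0.
by rewrite mulr_ge0 ?expR_ge0// exprn_ge0// invr_ge0 ltW.
Qed.

(** This is [y^n / n! <= e^y] for [y = 1 / x] and [n = j + 2]. A quadratic bound
makes the derivative at the origin vanish. *)
Lemma flat_le_sqr j x : flat j x <= j.+2`!%:R * x ^+ 2.
Proof.
rewrite /flat; case: ltP => x0; last by rewrite mulr_ge0// sqr_ge0.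
have y0 : 0 <= x^-1 by rewrite invr_ge0 ltW.
have := expR_ge1Dxn j.+1 y0.
rewrite expRN ler_pdivrMr ?expR_gt0// => H.
have {}H : x^-1 ^+ j.+2 / j.+2`!%:R <= expR x^-1.
  by apply: le_trans H; rewrite lerDr.
have f0 : 0 < (j.+2`!%:R : R) by rewrite ltr0n fact_gt0.
have -> : x^-1 ^+ j = j.+2`!%:R * x ^+ 2 * (x^-1 ^+ j.+2 / j.+2`!%:R).
  by rewrite !exprS; field; rewrite !gt_eqF.
by rewrite ler_wpM2l// mulr_ge0 ?sqr_ge0 ?ltW.
Qed.

Lemma is_diff_flat j x (L : clin R R) :
  (forall h, L h = h * (- j%:R * flat j.+1 x + flat j.+2 x)) ->
  is_diff x (flat j) L.
Proof.
have [x0|x0] := ltP 0 x => LE.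
  apply: (@is_diff_near R R R (fun x => x^-1 ^+ j * expR (- x^-1))).
    by near=> y; rewrite /flat; have -> : 0 < y by near: y; exact: lt_nbhsr.
  apply: (is_diff_real _ LE).
  have dV := @is_deriveV _ id x 1 1 (lt0r_neq0 x0) (is_derive_id _ _).
  have dX := is_deriveX j dV.
  have dE := @is_derive1_comp R expR (fun y => - y^-1) x _ _
    (is_derive_expR (- x^-1)) (is_deriveN dV).
  have dM := is_deriveM dX dE.
  rewrite (_ : (fun y => _) = ([eta GRing.inv] ^+ j) * (expR \o (fun y => - y^-1))).
    apply: is_derive_eq dM _.
    have -> : ([eta GRing.inv] ^+ j) x = x^-1 ^+ j by rewrite exprfctE.
    rewrite /flat x0 /GRing.scale /= -exprVn.
    case: (j) => [|i]; first by rewrite /= !(mul0r,oppr0,mulr0) !exprS; ring.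
    by rewrite /= !exprS; ring.
  by apply/funext => y; rewrite /= fctE exprfctE.
(* [flat j y] vanishes unless [y > 0 >= x], and then [y <= |y - x|] *)
have {}LE h : L h = 0 by rewrite LE /flat ltNge x0/= mulr0 addr0 mulr0.
apply/is_diff_epsP => e e0; near=> y.
rewrite LE subr0 {2}/flat ltNge x0 subr0 ger0_norm ?flat_ge0//.
have [y0|y0] := leP y 0; first by rewrite /flat ltNge y0 mulr_ge0// ltW.
apply: le_trans (flat_le_sqr _ _) _.
have C0 : 0 < (j.+2`!%:R : R) by rewrite ltr0n fact_gt0.
have yx : y <= `|y - x| by apply: le_trans (ler_norm _); rewrite lerBrDr gerDl.
apply: (@le_trans _ _ (j.+2`!%:R * `|y - x| ^+ 2)).
  apply: ler_wpM2l; first exact: ltW.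
  by rewrite ler_sqr ?nnegrE// ltW.
rewrite expr2 mulrA ler_wpM2r// mulrC -ler_pdivlMr// distrC.
by near: y; apply: cvgr_dist_le; [exact: cvg_id|rewrite divr_gt0].
Unshelve. all: by end_near. Qed.

Lemma Ck_flat k j (U : set R) : Ck_on k U (flat j).
Proof.
elim: k j => [|k IH] j.
  have [m mE] := scalar_clin_exists R.
  move=> x _; apply: (is_diff_cont (is_diff_flat (mE _))).
have [m mE] := scalar_clin_exists R.
exists (m \o (fun x => - j%:R * flat j.+1 x + flat j.+2 x)); split.
  by move=> x _; apply: is_diff_flat => h; rewrite mE.
apply: (Ck_comp (V := setT)) => //; last exact: Ck_clin.
by apply: CkD => //; apply: CkM => //; exact: Ck_cst.
Qed.

(** For [x > 0] this is [x * exp (- 1 / x)], the perspective of the convex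
function [exp (- y)]. It is thus convex on the whole line, unlike [flat 0]. *)
Definition hinge (x : R) := x * flat 0 x.

Lemma Ck_hinge k (U : set R) : Ck_on k U hinge.
Proof. by apply: CkM; [exact: Ck_id|exact: Ck_flat]. Qed.

Lemma hinge_le0 x : x <= 0 -> hinge x = 0.
Proof. by move=> x0; rewrite /hinge /flat ltNge x0 mulr0. Qed.

Lemma hinge_ge0 x : 0 <= hinge x.
Proof.
have [x0|x0] := leP x 0; first by rewrite hinge_le0.
by rewrite mulr_ge0 ?flat_ge0// ltW.
Qed.

Lemma hinge_gt0 x : 0 < x -> 0 < hinge x.
Proof. by move=> x0; rewrite /hinge /flat x0 expr0 mul1r mulr_gt0 ?expR_gt0. Qed.

(** The tangent of [exp (- w)] at [w = 1 / x], evaluated at [w = 1 / y] and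
multiplied by [y]. *)
Lemma hinge_tangent x : exists s, [/\ 0 <= s, 0 < x -> 0 < s &
  forall y, hinge x + s * (y - x) <= hinge y].
Proof.
have [x0|x0] := leP x 0.
  by exists 0; split=> // y; rewrite mul0r addr0 hinge_le0// hinge_ge0.
pose z := x^-1.
have z0 : 0 < z by rewrite invr_gt0.
exists (expR (- z) * (1 + z)); split=> [||y].
- by rewrite mulr_ge0 ?expR_ge0// addr_ge0// ltW.
- by rewrite mulr_gt0 ?expR_gt0// addr_gt0.
have -> : hinge x + expR (- z) * (1 + z) * (y - x) = expR (- z) * (y * (1 + z) - 1).
  rewrite /hinge /flat x0 expr0 -/z.
  have -> : x = z^-1 by rewrite invrK.
  by field; rewrite gt_eqF.
have [y0|y0] := leP y 0.
  rewrite hinge_le0// pmulr_rle0 ?expR_gt0// subr_le0 (le_trans _ ler01)//.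
  by rewrite mulr_le0_ge0// addr_ge0// ltW.
rewrite /hinge /flat y0 expr0 mul1r.
have -> : y * expR (- y^-1) = expR (- z) * (y * expR (z - y^-1)).
  by rewrite mulrCA -expRD addrA addNr add0r.
rewrite ler_wpM2l ?expR_ge0//.
have -> : y * (1 + z) - 1 = y * (1 + (z - y^-1)) by field; rewrite gt_eqF.
by rewrite ler_wpM2l ?(ltW y0)// expR_ge1Dx.
Qed.

Lemma hinge_le x y : x <= y -> hinge x <= hinge y.
Proof.
move=> xy; have [s [s0 _ /(_ y)]] := hinge_tangent x; apply: le_trans.
by rewrite lerDl mulr_ge0// subr_ge0.
Qed.

Lemma hinge_lt x y : 0 < x -> x < y -> hinge x < hinge y.
Proof.
move=> x0 xy; have [s [_ /(_ x0) s0 /(_ y)]] := hinge_tangent x; apply: lt_le_trans.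
by rewrite ltrDl mulr_gt0// subr_gt0.
Qed.

Lemma hinge_convex (a b x y : R) : 0 <= a -> 0 <= b -> a + b = 1 ->
  hinge (a * x + b * y) <= a * hinge x + b * hinge y.
Proof.
move=> a0 b0 ab; set m := _ + _; have [s [_ _ sP]] := hinge_tangent m.
apply: le_trans (lerD (ler_wpM2l a0 (sP x)) (ler_wpM2l b0 (sP y))).
rewrite {sP}/m.
rewrite le_eqVlt; apply/orP; left; apply/eqP.
have -> : b = 1 - a by rewrite -ab addrAC subrr add0r.
by ring.
Qed.

End Flat.

Lemma sqr_convex (R : realDomainType) (a b p q : R) :
  0 <= a -> 0 <= b -> a + b = 1 ->
  (a * p + b * q) * (a * p + b * q) <= a * (p * p) + b * (q * q).
Proof.
move=> a0 b0 ab; rewrite -subr_ge0.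
have -> : b = 1 - a by lra.
rewrite (_ : _ - _ = a * (1 - a) * (p - q) ^+ 2); last by ring.
by rewrite mulr_ge0 ?sqr_ge0// mulr_ge0//; lra.
Qed.

Section Barrier.
Variables (R : realType) (eps : R).
Hypothesis eps0 : 0 < eps.

(** The first factor normalizes the value at [1 + eps] to 1. Convexity comes from
[hinge] being convex and nondecreasing and [r * r - 1] being convex. *)
Definition barrier (r : R) :=
  (hinge ((1 + eps) * (1 + eps) - 1))^-1 * hinge (r * r - 1).

Let base_gt0 : 0 < (1 + eps) * (1 + eps) - 1.
Proof.
have -> : (1 + eps) * (1 + eps) - 1 = eps * (2 + eps) by ring.
by rewrite mulr_gt0// addr_gt0.
Qed.

Let height_gt0 : 0 < hinge ((1 + eps) * (1 + eps) - 1) := hinge_gt0 base_gt0.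

Lemma barrier_eq0 r : `|r| <= 1 -> barrier r = 0.
Proof.
rewrite ler_norml => /andP[? ?].
by rewrite /barrier (@hinge_le0 _ (r * r - 1)) ?mulr0// subr_le0; nra.
Qed.

Lemma barrier_ge0 r : 0 <= barrier r.
Proof. by rewrite mulr_ge0 ?hinge_ge0// invr_ge0 ltW. Qed.

Lemma barrier_le0 r : barrier r <= 0 -> `|r| <= 1.
Proof.
rewrite /barrier pmulr_rle0 ?invr_gt0// => h; rewrite leNgt; apply/negP => r1.
have : 0 < r * r - 1.
  by rewrite subr_gt0 -expr2 -(real_normK (num_real r)) expr_gt1.
by move=> /hinge_gt0; rewrite ltNge h.
Qed.

Lemma barrier_gt1 r : 1 + eps < `|r| -> 1 < barrier r.
Proof.
move=> r1; rewrite /barrier ltr_pdivlMl// mulr1; apply: (hinge_lt base_gt0).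
rewrite ltrD2r; have -> : r * r = `|r| * `|r|.
  by rewrite -expr2 -(real_normK (num_real r)) expr2.
by apply: ltr_pM => //; rewrite addr_ge0// ltW.
Qed.

Lemma barrier_opp r : barrier (- r) = barrier r.
Proof. by rewrite /barrier mulrNN. Qed.

Lemma barrier_convex (a b p q : R) : 0 <= a -> 0 <= b -> a + b = 1 ->
  barrier (a * p + b * q) <= a * barrier p + b * barrier q.
Proof.
move=> a0 b0 ab; rewrite /barrier !(mulrCA _ _^-1) -mulrDr.
rewrite ler_wpM2l ?invr_ge0 ?(ltW height_gt0)//.
apply: le_trans (hinge_convex _ _ a0 b0 ab); apply: hinge_le.
have := sqr_convex p q a0 b0 ab; lra.
Qed.

Lemma Ck_barrier k (U : set R) : Ck_on k U barrier.
Proof.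
apply: CkM; first exact: Ck_cst.
apply: (@Ck_comp R k R R R U setT (fun r => r * r - 1) (@hinge R)) => //.
  by apply: CkD; [apply: CkM; exact: Ck_id|exact: Ck_cst].
exact: Ck_hinge.
Qed.

End Barrier.

(** * A planar lens with two corners *)

Section Lens.
Variable R : realType.

(** On the strip [|t| < 1] the sublevel set at 1 is bounded by the parabolas
[s = 1 - t^2] and [s = t^2 - 1], which cross at [(0, 1)] and [(0, -1)]. These
corners are on the edge of the strip, where the formula stops being smooth. *)
Definition lens (s t : R) := t * t + s * s * (1 - t * t)^-1.

Lemma one_sub_sqr_gt0 (t : R) : `|t| < 1 -> 0 < 1 - t * t.
Proof. rewrite ltr_norml => /andP[]; nra. Qed.

Lemma lens_le1 s t : `|t| < 1 -> (lens s t <= 1) = (`|s| <= 1 - t * t).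
Proof.
move=> /one_sub_sqr_gt0 t1.
rewrite /lens -lerBrDl ler_pdivrMr//; move: t1; rewrite -!expr2 => t1.
by rewrite -(real_normK (num_real s)) ler_sqr ?nnegrE ?normr_ge0 ?(ltW t1).
Qed.

Lemma square_in_lens (s t : R) : `|t + s| <= 1 -> `|t - s| <= 1 -> `|s| <= 1 - t * t.
Proof. rewrite !ler_norml => /andP[? ?] /andP[? ?]; apply/andP; split; nra. Qed.

Lemma lens_in_square (s t : R) : `|t| < 1 -> `|s| <= 1 - t * t ->
  `|t + 2^-1 * s| <= 1 /\ `|t - 2^-1 * s| <= 1.
Proof.
rewrite ltr_norml !ler_norml => /andP[? ?] /andP[? ?].
split; apply/andP; split; nra.
Qed.

(** The right-hand side is the largest of these linear functions of [(s, r)],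
attained for [w = s / r]; hence it is jointly convex. *)
Lemma perspective_tangent (w s r : R) : 0 < r ->
  2 * w * s - w * w * r <= s * s * r^-1.
Proof.
move=> r0; rewrite ler_pdivlMr//; have := sqr_ge0 (s - w * r); rewrite expr2; nra.
Qed.

Lemma perspective_convex (a b s1 s2 r1 r2 : R) : 0 <= a -> 0 <= b -> a + b = 1 ->
  0 < r1 -> 0 < r2 ->
  (a * s1 + b * s2) * (a * s1 + b * s2) * (a * r1 + b * r2)^-1 <=
  a * (s1 * s1 * r1^-1) + b * (s2 * s2 * r2^-1).
Proof.
move=> a0 b0 ab r10 r20; set s := a * s1 + b * s2; set r := a * r1 + b * r2.
have r0 : 0 < r.
  rewrite /r; have -> : b = 1 - a by lra.
  have [a1|] := ltP a 1; last by nra.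
  have : 0 <= a * r1 by rewrite mulr_ge0// ltW.
  have : 0 < (1 - a) * r2 by rewrite mulr_gt0// subr_gt0.
  lra.
have H1 := ler_wpM2l a0 (perspective_tangent (s * r^-1) s1 r10).
have H2 := ler_wpM2l b0 (perspective_tangent (s * r^-1) s2 r20).
apply: le_trans (lerD H1 H2); rewrite le_eqVlt; apply/orP; left; apply/eqP.
transitivity (2 * (s * r^-1) * s - (s * r^-1) * (s * r^-1) * r).
  by field; rewrite gt_eqF.
by move: (s * r^-1) => w; rewrite /s /r; ring.
Qed.

Lemma lens_convex (a b s1 s2 t1 t2 : R) : 0 <= a -> 0 <= b -> a + b = 1 ->
  `|t1| < 1 -> `|t2| < 1 ->
  lens (a * s1 + b * s2) (a * t1 + b * t2) <= a * lens s1 t1 + b * lens s2 t2.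
Proof.
(* partial fractions exhibit two perspectives of the square *)
have lensE s t : `|t| < 1 ->
    lens s t = t * t + 2^-1 * (s * s * (1 - t)^-1 + s * s * (1 + t)^-1).
  by rewrite ltr_norml => /andP[? ?]; rewrite /lens; field; apply/and3P; split;
    apply: lt0r_neq0; nra.
move=> a0 b0 ab t11 t21.
have tm1 : `|a * t1 + b * t2| < 1.
  move: t11 t21; rewrite !ltr_norml => /andP[? ?] /andP[? ?].
  have -> : b = 1 - a by lra.
  have [?|?] := ltP 0 a; apply/andP; split; nra.
rewrite !lensE//.
move: t11 t21; rewrite !ltr_norml => /andP[? ?] /andP[? ?].
have := @perspective_convex a b s1 s2 (1 - t1) (1 - t2) a0 b0 ab.
have := @perspective_convex a b s1 s2 (1 + t1) (1 + t2) a0 b0 ab.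
have -> : a * (1 + t1) + b * (1 + t2) = 1 + (a * t1 + b * t2) by lra.
have -> : a * (1 - t1) + b * (1 - t2) = 1 - (a * t1 + b * t2) by lra.
move=> /(_ _ _)H1 /(_ _ _)H2.
have {}H1 : _ := H1 ltac:(lra) ltac:(lra).
have {}H2 : _ := H2 ltac:(lra) ltac:(lra).
have : (a * t1 + b * t2) * (a * t1 + b * t2) <= a * (t1 * t1) + b * (t2 * t2).
  exact: sqr_convex.
move: H1 H2; lra.
Qed.

End Lens.

(** * The gauge of a symmetric convex body *)

(** Closedness along rays from the origin is what makes [B] equal to the closed
unit ball of its gauge. *)
Record norm_body (R : realType) (E : normedModType R) (B : set E) (M : R) : Prop := {
  nb_radius_gt0 : 0 < M ;
  nb_convex : forall (a b : R) x y, 0 <= a -> 0 <= b -> a + b = 1 ->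
    B x -> B y -> B (a *: x + b *: y) ;
  nb_opp : forall x, B x -> B (- x) ;
  nb_ball : forall x, `|x| <= 1 -> B x ;
  nb_bounded : forall x, B x -> `|x| <= M ;
  nb_radial : forall z, (forall c : R, 0 <= c -> c < 1 -> B (c *: z)) -> B z }.

Definition gauge (R : realType) (E : normedModType R) (B : set E) (x : E) : R :=
  inf [set l | 0 < l /\ B (l^-1 *: x)].

Section Gauge.
Variables (R : realType) (E : normedModType R) (B : set E) (M : R).
Hypothesis BM : norm_body B M.

Let M0 := nb_radius_gt0 BM.
Let B_ball := nb_ball BM.
Let B_bounded := nb_bounded BM.

Lemma norm_body_star c x : 0 <= c -> c <= 1 -> B x -> B (c *: x).
Proof.
move=> c0 c1 Bx; rewrite -[_ *: _]addr0 -(scaler0 _ (1 - c)).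
apply: (nb_convex BM) => //; rewrite ?subr_ge0// ?subrKC//.
by apply: B_ball; rewrite normr0.
Qed.

Lemma gauge_has_inf x : has_inf [set l | 0 < l /\ B (l^-1 *: x)].
Proof.
split; last by exists 0 => l [/ltW].
have l0 : 0 < `|x| + 1 by rewrite ltr_wpDl.
exists (`|x| + 1); split=> //; apply: B_ball.
by rewrite normrZ normfV (gtr0_norm l0) ler_pdivrMl// mulr1 lerDl.
Qed.

Lemma gauge_le l x : 0 < l -> B (l^-1 *: x) -> gauge B x <= l.
Proof. by move=> l0 Bl; apply: ge_inf; [case: (gauge_has_inf x)|]. Qed.

Lemma gauge_ge m x : (forall l, 0 < l -> B (l^-1 *: x) -> m <= l) -> m <= gauge B x.
Proof.
by move=> ml; apply: lb_le_inf => [|l [l0 Bl]]; [case: (gauge_has_inf x)|exact: ml].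
Qed.

Lemma gauge_le_norm x : gauge B x <= `|x|.
Proof.
apply/ler_addgt0Pr => e e0; apply: gauge_le; first by rewrite ltr_wpDl.
apply: B_ball; rewrite normrZ normfV gtr0_norm ?ltr_wpDl//.
by rewrite ler_pdivrMl ?ltr_wpDl// mulr1 lerDl ltW.
Qed.

Lemma norm_le_gauge x : `|x| <= M * gauge B x.
Proof.
rewrite -ler_pdivrMl//; apply: gauge_ge => l l0 /B_bounded.
by rewrite normrZ normfV gtr0_norm// ler_pdivrMl// ler_pdivrMl// mulrC.
Qed.

Lemma gauge_ge0 x : 0 <= gauge B x.
Proof. by apply: gauge_ge => l /ltW. Qed.

Lemma gaugeD x y : gauge B (x + y) <= gauge B x + gauge B y.
Proof.
rewrite -lerBlDr; apply: gauge_ge => l l0 Bl.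
rewrite lerBlDr [l + _]addrC -lerBlDr; apply: gauge_ge => m m0 Bm.
rewrite lerBlDr; have ml0 : 0 < m + l by rewrite addr_gt0.
apply: gauge_le => //.
have -> : (m + l)^-1 *: (x + y) =
    (l / (m + l)) *: (l^-1 *: x) + (m / (m + l)) *: (m^-1 *: y).
  by rewrite !scalerA scalerDr !(mulrAC _ (m + l)^-1) !mulfV ?gt_eqF// !mul1r.
apply: (nb_convex BM) => //; try by rewrite divr_ge0// ltW.
by rewrite -mulrDl addrC mulfV// gt_eqF.
Qed.

Lemma gaugeZ (a : R) x : gauge B (a *: x) = `|a| * gauge B x.
Proof.
have le_Z b z : b != 0 -> gauge B (b *: z) <= `|b| * gauge B z.
  move=> b0; have nb0 : 0 < `|b| by rewrite normr_gt0.
  rewrite -ler_pdivrMl//; apply: gauge_ge => l l0 Bl.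
  rewrite ler_pdivrMl//; apply: gauge_le; first by rewrite mulr_gt0.
  rewrite invfM scalerA mulrAC.
  have [bp|bn] := ltP 0 b.
    by rewrite gtr0_norm// mulVf// mul1r.
  by rewrite ler0_norm// invrN mulNr mulVf// mulN1r scaleNr; exact: (nb_opp BM).
have [->|a0] := eqVneq a 0.
  rewrite normr0 mul0r scale0r; apply/eqP; rewrite eq_le gauge_ge0 andbT.
  by apply: le_trans (gauge_le_norm _) _; rewrite normr0.
apply/eqP; rewrite eq_le le_Z//=.
rewrite -ler_pdivlMl ?normr_gt0// -normfV.
by rewrite -{1}(scale1r x) -(mulVf a0) -scalerA le_Z// invr_neq0.
Qed.

Lemma gauge_gt0 x : x != 0 -> 0 < gauge B x.
Proof.
move=> x0; rewrite lt0r gauge_ge0 andbT; apply/eqP => g0.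
by have := norm_le_gauge x; rewrite g0 mulr0 normr_le0 (negbTE x0).
Qed.

Lemma gauge_is_norm : is_norm (gauge B).
Proof.
split=> [||x gx]; [exact: gaugeD|exact: gaugeZ|].
by apply/eqP; apply/negP => /negP/gauge_gt0; rewrite gx ltxx.
Qed.

Lemma gauge_lipschitz x y : `|gauge B x - gauge B y| <= `|x - y|.
Proof.
have H z w : gauge B z - gauge B w <= `|z - w|.
  rewrite lerBlDr -{1}(subrK w z); apply: le_trans (gaugeD _ _) _.
  by rewrite lerD2r gauge_le_norm.
by rewrite ler_norml H andbT lerNl opprB distrC H.
Qed.

Lemma gauge_normalize x : x != 0 -> B ((gauge B x)^-1 *: x).
Proof.
move=> /gauge_gt0 g0; apply: (nb_radial BM) => c c0 c1.
have [c0'|c0'] := ltP 0 c; last first.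
  have -> : c = 0 by apply/eqP; rewrite eq_le c0 c0'.
  by rewrite scale0r; apply: B_ball; rewrite normr0.
have : gauge B x < gauge B x / c by rewrite ltr_pdivlMr// gtr_pMr.
move=> /inf_lt[|l [l0 Bl] lc]; first exact: (gauge_has_inf x).1.
have -> : c *: ((gauge B x)^-1 *: x) = (c / gauge B x * l) *: (l^-1 *: x).
  by rewrite !scalerA mulfK ?gt_eqF.
apply: norm_body_star => //; first by rewrite !mulr_ge0 ?invr_ge0 ?ltW.
by rewrite mulrAC ler_pdivrMr// mul1r mulrC -ler_pdivlMr// ltW.
Qed.

Lemma gauge_le1 x : gauge B x <= 1 <-> B x.
Proof.
split=> [gx|Bx]; last by apply: gauge_le; rewrite ?invr1 ?scale1r.
have [->|x0] := eqVneq x 0; first by apply: B_ball; rewrite normr0.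
have g0 := gauge_gt0 x0.
have -> : x = gauge B x *: ((gauge B x)^-1 *: x).
  by rewrite scalerA mulfV ?scale1r ?gt_eqF.
by apply: norm_body_star => //; [exact: ltW|exact: gauge_normalize].
Qed.

End Gauge.

(** * Functionals and coordinate sums on c_0 *)

Section C0Tools.
Variable R : realType.
Implicit Types x y : c0 R.

Lemma c0E_add x y n : (x + y) n = x n + y n.
Proof. by []. Qed.

Lemma c0E_scale (a : R) x n : (a *: x) n = a * x n.
Proof. by []. Qed.

Lemma c0E_opp x n : (- x) n = - x n.
Proof. by []. Qed.

Lemma c0_coord_le x n : `|x n| <= `|x|.
Proof. exact: c0_le_norm. Qed.

Lemma c0_tail x (e : R) : 0 < e -> exists n, forall k, (n <= k)%N -> `|x k| <= e.
Proof.
move=> e0; have /cvgrPdist_le/(_ _ e0)[n _ xn] := @c0_cvg R x.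
by exists n => k /xn /=; rewrite sub0r normrN.
Qed.

Lemma ones_mem n : (fun k => (k < n)%N%:R : R) \in @c0_pred R.
Proof.
apply/asboolP; apply: cvg_near_cst; near=> k.
by rewrite ltnNge; have -> : (n <= k)%N by near: k; exact: nbhs_infty_ge.
Unshelve. all: by end_near. Qed.

Definition ones n : c0 R := C0 (ones_mem n).

Lemma onesE n k : ones n k = (k < n)%N%:R.
Proof. by []. Qed.

Lemma ones_norm n : `|ones n| <= 1.
Proof.
by apply: c0_norm_le => k; rewrite onesE; case: ltnP; rewrite ?normr1 ?normr0.
Qed.

Section Geometric.
Variable rho : R.
Hypotheses (rho0 : 0 < rho) (rho1 : rho < 1).

Let part x n : R := \sum_(0 <= k < n) (1 - rho) * rho ^+ k * x k.

Lemma geometric_weights n : \sum_(0 <= k < n) (1 - rho) * rho ^+ k = 1 - rho ^+ n.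
Proof.
elim: n => [|n IH]; first by rewrite big_geq// expr0 subrr.
by rewrite big_nat_recr//= IH exprS; ring.
Qed.

Let w_ge0 k : 0 <= (1 - rho) * rho ^+ k.
Proof. by rewrite mulr_ge0 ?subr_ge0 ?exprn_ge0// ltW. Qed.

Let part_le x n : `|part x n| <= (1 - rho ^+ n) * `|x|.
Proof.
rewrite /part -geometric_weights mulr_suml.
apply: le_trans (ler_norm_sum _ _ _) _; apply: ler_sum => k _.
by rewrite normrM ger0_norm// ler_wpM2l// c0_coord_le.
Qed.

Let part_cvg x : cvgn (part x).
Proof.
apply: (@normed_cvg _ R^o (fun k => (1 - rho) * rho ^+ k * x k)).
apply: (@series_le_cvg _ _ (fun k => geometric ((1 - rho) * `|x|) rho k)).
- by move=> k; exact: normr_ge0.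
- by move=> k; rewrite /geometric/= !mulr_ge0 ?subr_ge0 ?exprn_ge0// ltW.
- move=> k /=; rewrite normrM (ger0_norm (w_ge0 _)) /geometric /= [leRHS]mulrAC.
  by rewrite ler_wpM2l// c0_coord_le.
- by apply: is_cvg_geometric_series; rewrite ger0_norm// ltW.
Qed.

(** The functional has the weights [(1 - rho) * rho ^+ k], which are positive and
have sum 1. *)
Lemma geometric_functional : exists L : clin (c0 R) R,
  (forall x, `|L x| <= `|x|) /\ (forall n, L (ones n) = 1 - rho ^+ n).
Proof.
pose A x := limn (part x).
have Ax x : part x @ \oo --> A x := part_cvg (x := x).
have A1 x : `|A x| <= `|x|.
  apply: (cvgr_to_le (cvg_norm (Ax x))); near=> n.
  apply: le_trans (part_le _ _) _.
  by rewrite ler_piMl// lerBlDr lerDl exprn_ge0// ltW.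
have lA : linear A.
  move=> a x y; apply/cvg_lim => //.
  have -> : part (a *: x + y) = (fun n => a * part x n + part y n).
    apply/funext => n; rewrite /part mulr_sumr -big_split; apply: eq_bigr => k _.
    by rewrite c0E_add c0E_scale /=; ring.
  apply: cvgD => //; apply: cvgM => //; exact: cvg_cst.
have [x|L LE] := @clin_exists R (c0 R) R A 1 lA; first by rewrite mul1r.
exists L; split=> [x|n]; first by rewrite LE.
rewrite LE; apply/cvg_lim => //; apply: cvg_near_cst; near=> m.
have nm : (n <= m)%N by near: m; exact: nbhs_infty_ge.
rewrite /part (big_cat_nat (leq0n n) nm)//=.
rewrite [X in _ + X]big_nat_cond [X in _ + X]big1 ?addr0.
  rewrite -geometric_weights; apply: eq_big_nat => k /andP[_ kn].
  by rewrite /= kn mulr1.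
by move=> k /andP[/andP[nk _] _]; rewrite /= ltnNge nk mulr0.
Unshelve. all: by end_near. Qed.

(** The norm is not attained: some coordinate of [x] is at most 1/2 in absolute
value, and raising it by 1/2 stays in the ball and increases [L], all weights
being positive. *)
Lemma geometric_functional_lt (L : clin (c0 R) R) :
  (forall x, `|L x| <= `|x|) -> (forall n, L (ones n) = 1 - rho ^+ n) ->
  forall x, `|x| <= 1 -> `|L x| < 1.
Proof.
move=> L1 Lones.
suff H x : `|x| <= 1 -> L x < 1.
  move=> x x1; rewrite ltr_norml H// andbT ltrNl -linearN; apply: H.
  by rewrite normrN.
move=> x1; have h0 : (0 : R) < 2^-1 by rewrite invr_gt0.
have [k xk] := c0_tail x h0.
pose e := ones k.+1 - ones k.
have Le : 0 < L e.
  rewrite linearB /= !Lones exprS.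
  have : 0 < rho ^+ k * (1 - rho) by rewrite mulr_gt0 ?exprn_gt0// subr_gt0.
  lra.
have /(le_trans (ler_norm _)) := L1 (x + 2^-1 *: e).
have : `|x + 2^-1 *: e| <= 1.
  apply: c0_norm_le => i; rewrite c0E_add c0E_scale.
  have -> : e i = (i == k)%:R.
    rewrite [LHS](_ : _ = ones k.+1 i - ones k i)// !onesE ltnS.
    by case: ltngtP; rewrite ?subrr ?subr0.
  case: eqVneq => [->|_]; last by rewrite mulr0 addr0 (le_trans (c0_coord_le _ _)).
  rewrite mulr1; apply: le_trans (ler_normD _ _) _.
  rewrite (ger0_norm (ltW h0)); have := xk k (leqnn k); lra.
have -> : L (x + 2^-1 *: e) = L x + 2^-1 * L e by rewrite [LHS]linearD linearZ.
lra.
Qed.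

End Geometric.

Section CoordSum.
Variable phi : R -> R.
Hypothesis phi0 : forall r, `|r| <= 1 -> phi r = 0.

(** Each [x] in c_0 has finitely many coordinates with [phi (x i) <> 0]; the
limit accounts for their number depending on [x]. *)
Definition coord_sum x : R := limn (fun n => \sum_(i < n) phi (x i)).

Lemma coord_sumE n x : (forall i, (n <= i)%N -> `|x i| <= 1) ->
  coord_sum x = \sum_(i < n) phi (x i).
Proof.
move=> xn; apply/cvg_lim => //; apply: cvg_near_cst; near=> m.
have nm : (n <= m)%N by near: m; exact: nbhs_infty_ge.
rewrite -!(big_mkord xpredT (fun i => phi (x i))) (big_cat_nat (leq0n n) nm)//=.
rewrite [X in _ + X]big_nat_cond [X in _ + X]big1 ?addr0//.
by move=> k /andP[/andP[nk _] _]; exact/phi0/xn.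
Unshelve. all: by end_near. Qed.

Lemma coord_sum_ball x : `|x| <= 1 -> coord_sum x = 0.
Proof.
move=> x1; rewrite (@coord_sumE 0%N) ?big_ord0// => i _.
exact: le_trans (c0_coord_le _ _) x1.
Qed.

Lemma Ck_coord k n (U : set (c0 R)) : Ck_on k U (fun x => x n : R).
Proof.
have [|x|L LE] := @clin_exists R (c0 R) R (fun x => x n) 1.
- by move=> a x y; rewrite c0E_add c0E_scale.
- by rewrite mul1r c0_coord_le.
- by rewrite -(_ : L = (fun x => x n) :> (c0 R -> R)); [exact: Ck_clin|exact/funext].
Qed.

(** Beyond some rank the coordinates of [x] are at most 1/2, so those of the
points at distance less than 1/2 from [x] are at most 1: on this ball the sum
has a fixed finite set of terms. *)
Lemma Ck_coord_sum k (U : set (c0 R)) : Ck_on k setT phi -> Ck_on k U coord_sum.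
Proof.
move=> phik; apply: Ck_local => x _.
have h0 : (0 : R) < 2^-1 by rewrite invr_gt0.
have [n xn] := c0_tail x h0.
exists (ball x 2^-1), (fun y => \sum_(i < n) phi (y i)); split.
- exact: ball_open.
- exact: ballxx.
- move=> y; rewrite -ball_normE /= => xy; apply: coord_sumE => i /xn xi.
  rewrite -(subrK (x i) (y i)); apply: le_trans (ler_normD _ _) _.
  have := c0_coord_le (y - x) i.
  rewrite distrC in xy; rewrite [X in `|X|](_ : _ = y i - x i)//; lra.
- apply: (@Ck_sum _ _ _ _ _ _ (fun i y => phi (y i))) => i.
  by apply: (Ck_comp (V := setT)) phik => //; exact: Ck_coord.
Qed.

Lemma coord_sum_common x y : exists n,
  (forall i, (n <= i)%N -> `|x i| <= 1) /\ (forall i, (n <= i)%N -> `|y i| <= 1).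
Proof.
have [n xn] := c0_tail x ltr01; have [m ym] := c0_tail y ltr01.
exists (maxn n m); split=> i; rewrite geq_max => /andP[ni mi]; [exact: xn|exact: ym].
Qed.

Lemma coord_sum_convex (a b : R) x y : 0 <= a -> 0 <= b -> a + b = 1 ->
  (forall p q, phi (a * p + b * q) <= a * phi p + b * phi q) ->
  coord_sum (a *: x + b *: y) <= a * coord_sum x + b * coord_sum y.
Proof.
move=> a0 b0 ab phi_cvx; have [n [xn yn]] := coord_sum_common x y.
rewrite !(@coord_sumE n)// => [|i ni].
  rewrite !mulr_sumr -big_split; apply: ler_sum => i _ /=.
  exact: phi_cvx.
rewrite c0E_add !c0E_scale; apply: le_trans (ler_normD _ _) _.
rewrite !normrM (ger0_norm a0) (ger0_norm b0) -ab.
by rewrite lerD// ler_piMr// ?xn ?yn.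
Qed.

Lemma coord_sum_opp x : (forall r, phi (- r) = phi r) ->
  coord_sum (- x) = coord_sum x.
Proof.
move=> phiN; have [n xn] := c0_tail x ltr01.
rewrite !(@coord_sumE n)// => [|i ni]; last by rewrite c0E_opp normrN xn.
by apply: eq_bigr => i _; rewrite c0E_opp phiN.
Qed.

Lemma le_coord_sum x i : (forall r, 0 <= phi r) -> phi (x i) <= coord_sum x.
Proof.
move=> phi_ge0; have [n xn] := c0_tail x ltr01.
rewrite (@coord_sumE (maxn n i.+1)) => [|j]; last first.
  by rewrite geq_max => /andP[/xn].
have im : (i < maxn n i.+1)%N by rewrite leq_max ltnSn orbT.
by rewrite (bigD1 (Ordinal im))//= lerDl sumr_ge0.
Qed.

End CoordSum.
End C0Tools.

(** * The unit ball *)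

Section Construction.
Variables (R : realType) (eps : R) (t s : clin (c0 R) R).
Hypothesis eps0 : 0 < eps.
Hypothesis tsD : forall x, `|x| <= 1 -> `|t x + s x| < 1.
Hypothesis tsB : forall x, `|x| <= 1 -> `|t x - s x| < 1.

Let V : set (c0 R) := [set x | `|t x| < 1].

Definition body_fun (x : c0 R) : R := coord_sum (barrier eps) x + lens (s x) (t x).
Definition body : set (c0 R) := [set x | `|t x| < 1 /\ body_fun x <= 1].

Let barrier0 : forall r : R, `|r| <= 1 -> barrier eps r = 0.
Proof. by move=> r; exact: barrier_eq0. Qed.

Let barrier_pos : forall r : R, 0 <= barrier eps r.
Proof. by move=> r; exact: barrier_ge0. Qed.

Lemma ball_slab x : `|x| <= 1 -> V x.
Proof.
move=> x1; rewrite /V /=; have := tsD x1; have := tsB x1.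
rewrite !ltr_norml => /andP[? ?] /andP[? ?]; apply/andP; split; lra.
Qed.

Lemma coord_sum_pos x : 0 <= coord_sum (barrier eps) x.
Proof. exact: le_trans (barrier_pos _) (le_coord_sum barrier0 x 0 barrier_pos). Qed.

Lemma body_ball x : `|x| <= 1 -> body x.
Proof.
move=> x1; have tx := ball_slab x1; split=> //.
rewrite /body_fun coord_sum_ball// add0r lens_le1//.
by apply: square_in_lens; rewrite ltW ?tsD ?tsB.
Qed.

Lemma body_lens x : body x -> lens (s x) (t x) <= 1.
Proof. by move=> [_]; rewrite /body_fun; have := coord_sum_pos x; lra. Qed.

Lemma body_coord x i : body x -> barrier eps (x i) + t x * t x <= 1.
Proof.
move=> [/one_sub_sqr_gt0 tx]; rewrite /body_fun /lens.
have := le_coord_sum barrier0 x i barrier_pos.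
have : 0 <= s x * s x * (1 - t x * t x)^-1.
  by rewrite mulr_ge0 ?invr_ge0 ?(ltW tx)// -expr2 sqr_ge0.
lra.
Qed.

Lemma body_bounded x : body x -> `|x| <= 1 + eps.
Proof.
move=> Bx; apply: c0_norm_le => i; rewrite leNgt; apply/negP => /(barrier_gt1 eps0).
have := body_coord i Bx; have := sqr_ge0 (t x); rewrite expr2; lra.
Qed.

Lemma body_opp x : body x -> body (- x).
Proof.
rewrite /body /body_fun /= !linearN normrN /lens !mulrNN => -[tx Fx]; split=> //.
by rewrite coord_sum_opp//; exact: barrier_opp.
Qed.

Lemma slab_convex (a b : R) x y : 0 <= a -> 0 <= b -> a + b = 1 ->
  V x -> V y -> V (a *: x + b *: y).
Proof.
move=> a0 b0 ab; rewrite /V /= linearD !linearZ /= !ltr_norml.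
move=> /andP[? ?] /andP[? ?]; have -> : b = 1 - a by lra.
by rewrite /GRing.scale /=; have [?|?] := ltP 0 a; apply/andP; split; nra.
Qed.

Lemma body_fun_convex (a b : R) x y : 0 <= a -> 0 <= b -> a + b = 1 ->
  V x -> V y -> body_fun (a *: x + b *: y) <= a * body_fun x + b * body_fun y.
Proof.
move=> a0 b0 ab Vx Vy; rewrite /body_fun.
have LE (L : clin (c0 R) R) : L (a *: x + b *: y) = a * L x + b * L y.
  by rewrite linearD !linearZ.
have H1 := lens_convex (s x) (s y) a0 b0 ab Vx Vy.
have H2 : coord_sum (barrier eps) (a *: x + b *: y) <=
    a * coord_sum (barrier eps) x + b * coord_sum (barrier eps) y.
  by apply: coord_sum_convex => // p q; exact: barrier_convex.
rewrite !LE; lra.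
Qed.

Lemma body_convex (a b : R) x y : 0 <= a -> 0 <= b -> a + b = 1 ->
  body x -> body y -> body (a *: x + b *: y).
Proof.
move=> a0 b0 ab [Vx Fx] [Vy Fy]; split; first exact: slab_convex.
apply: le_trans (body_fun_convex a0 b0 ab Vx Vy) _.
by rewrite -ab lerD// ler_piMr.
Qed.

Lemma Ck_body_fun k : Ck_on k V body_fun.
Proof.
apply: CkD.
  by apply: Ck_coord_sum => //; exact: Ck_barrier.
apply: CkD; first by apply: CkM; exact: Ck_clin.
apply: CkM; first by apply: CkM; exact: Ck_clin.
apply: (@CkV _ k _ _ (fun x => 1 - t x * t x)).
  by move=> x /one_sub_sqr_gt0; exact: lt0r_neq0.
apply: CkD; first exact: Ck_cst.
rewrite (_ : (fun x => _) = (fun x => -1 * (t x * t x))).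
  by apply: CkM; [exact: Ck_cst|apply: CkM; exact: Ck_clin].
by apply/funext => x; rewrite mulN1r.
Qed.

Lemma left_limit_le1 (f : R -> R) : {for 1, continuous f} ->
  (forall c, 0 <= c -> c < 1 -> f c <= 1) -> f 1 <= 1.
Proof.
move=> fc f1; apply: (@cvgr_to_le _ (1^'-) _ _ f (f 1)).
  by apply: cvg_within_filter; exact: fc.
near=> c; apply: f1; last by near: c; exact: nbhs_left_lt.
by near: c; exact: nbhs_left_ge.
Unshelve. all: by end_near. Qed.

Lemma scale_continuous_at1 (z : c0 R) : {for 1, continuous (fun c : R => c *: z)}.
Proof. by move=> ?; apply: scalel_continuous. Qed.

Lemma ray_cvg (f : c0 R -> R) (z : c0 R) : {for z, continuous f} ->
  f (c *: z) @[c --> (1 : R)] --> f z.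
Proof.
move=> fz; have := @scale_continuous_at1 z; rewrite /prop_for /continuous_at scale1r.
by move=> /cvg_comp; apply.
Qed.

(** If [|t z| >= 1], the limit of the inequality [body_coord] along the ray gives
[barrier eps (z i) <= 0] for all [i], so [z] is in the unit ball, on which
[|t| < 1]. Otherwise [body_fun] is continuous at [z]. *)
Lemma body_radial z : (forall c, 0 <= c -> c < 1 -> body (c *: z)) -> body z.
Proof.
move=> Bz.
have coordz i : barrier eps (z i) + t z * t z <= 1.
  pose f c := barrier eps (c * z i) + (c * t z) * (c * t z).
  suff: f 1 <= 1 by rewrite /f !mul1r.
  apply: left_limit_le1 => [|c c0 c1].
    suff /(_ 0%N) : forall k, Ck_on k setT f by apply.
    move=> k; apply: CkD; last first.
      by apply: CkM; apply: CkM; (exact: Ck_cst || exact: Ck_id).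
    apply: (@Ck_comp R k R R R setT setT (fun c => c * z i) (barrier eps)) => //.
      by apply: CkM; [exact: Ck_id|exact: Ck_cst].
    exact: Ck_barrier.
  by have := body_coord i (Bz c c0 c1); rewrite linearZ.
have Vz : V z.
  rewrite /V /= ltNge; apply/negP => tz.
  suff : `|t z| < 1 by rewrite ltNge tz.
  apply: ball_slab; apply: c0_norm_le => i; apply: (barrier_le0 eps0).
  have := coordz i.
  have : 1 <= t z * t z by rewrite -expr2 -(real_normK (num_real _)) expr_ge1.
  lra.
split=> //; rewrite -[z in body_fun z]scale1r.
apply: (left_limit_le1 (f := fun c => body_fun (c *: z))) => [|c c0 c1].
  apply: (@continuous_comp _ _ _ (fun c : R => c *: z) body_fun).
    exact: scale_continuous_at1.
  by rewrite scale1r; have := Ck_body_fun 0%N; apply.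
by case: (Bz c c0 c1).
Qed.

Lemma body_norm_body : norm_body body (1 + eps).
Proof.
split; [by rewrite addr_gt0|exact: body_convex|exact: body_opp|exact: body_ball|
  exact: body_bounded|exact: body_radial].
Qed.

Let N := gauge body.

(** If [body_fun] were less than 1 at this point of norm 1, continuity would put
points of norm greater than 1 into the body. *)
Lemma norm_body_fun1 x : x != 0 -> body_fun ((N x)^-1 *: x) = 1.
Proof.
move=> x0; have Nx : 0 < N x := gauge_gt0 body_norm_body x0.
set z := _ *: x.
have Nz : N z = 1.
  by rewrite /z /N (gaugeZ body_norm_body) normfV gtr0_norm// mulVf// gt_eqF.
have [Vz Fz] : body z := gauge_normalize body_norm_body x0.
apply/eqP; rewrite eq_le Fz/= leNgt; apply/negP => Fz1.
have Fc : {for z, continuous body_fun} by have := Ck_body_fun 0%N; apply.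
have tc : {for z, continuous (fun x => `|t x|)}.
  have tz : t x @[x --> z] --> t z := @clin_continuous R _ _ t z.
  exact: cvg_norm tz.
suff : \forall c \near (1 : R)^'+, False by move=> /filter_ex[].
near=> c.
have c1 : 1 < c by near: c; exact: nbhs_right_gt.
have : body (c *: z).
  split.
    near: c; apply: (cvgr_lt (`|t z|)) => //.
    by apply: cvg_at_right_filter; exact: ray_cvg tc.
  apply/ltW; near: c; apply: (cvgr_lt (body_fun z)) => //.
  by apply: cvg_at_right_filter; exact: ray_cvg Fc.
move=> /(gauge_le1 body_norm_body); rewrite (gaugeZ body_norm_body).
rewrite -/N Nz mulr1 gtr0_norm ?(lt_trans ltr01)//.
by rewrite leNgt c1.
Unshelve. all: by end_near. Qed.

(** Since [body_fun] is convex and vanishes at 0, it is at most [c] at [c *: z]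
for [0 <= c <= 1], so its derivative at [z] in the direction [z] is at least
1. *)
Lemma radial_derivative_neq0 z (L : clin (c0 R) R) :
  V z -> body_fun z = 1 -> is_diff z body_fun L -> L z != 0.
Proof.
move=> Vz Fz /is_diff_epsP FL; apply/eqP => Lz.
(* the coefficient only has to satisfy [e * |z| < 1] *)
have e0 : 0 < (2 * (`|z| + 1))^-1 by rewrite invr_gt0 mulr_gt0// ltr_wpDl.
have H : \forall c \near (1 : R)^'-,
    `|body_fun (c *: z) - body_fun z - L (c *: z - z)|
    <= (2 * (`|z| + 1))^-1 * `|c *: z - z|.
  apply: cvg_within; have := @scale_continuous_at1 z.
  rewrite /prop_for /continuous_at scale1r => sc; exact: (sc _ (FL _ e0)).
suff : \forall c \near (1 : R)^'-, False by move=> /filter_ex[].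
near=> c.
have c0 : 0 <= c by near: c; exact: nbhs_left_ge.
have c1 : c < 1 by near: c; exact: nbhs_left_lt.
have : `|body_fun (c *: z) - body_fun z - L (c *: z - z)|
    <= (2 * (`|z| + 1))^-1 * `|c *: z - z| by near: c.
have -> : c *: z - z = (c - 1) *: z by rewrite scalerBl scale1r.
rewrite linearZ /= Lz scaler0 subr0 normrZ Fz.
have V0 : V 0 by apply: ball_slab; rewrite normr0.
have F0 : body_fun 0 = 0.
  rewrite /body_fun coord_sum_ball ?normr0// /lens !linear0; ring.
have := @body_fun_convex c (1 - c) z 0 c0.
rewrite subr_ge0 => /(_ (ltW c1) (subrKC _ _) Vz V0).
rewrite scaler0 addr0 F0 Fz mulr0 addr0 mulr1 => Fc.
rewrite (distrC c) (ger0_norm (x := 1 - c)) ?subr_ge0 ?(ltW c1)//.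
rewrite leNgt => /negP; apply.
apply: (@lt_le_trans _ _ (1 - c)).
  rewrite mulrCA gtr_pMr ?subr_gt0// ltr_pdivrMl ?mulr_gt0 ?ltr_wpDl// mulr1.
  by have := normr_ge0 z; lra.
by rewrite distrC; apply: le_trans (ler_norm _); lra.
Unshelve. all: by end_near. Qed.

Lemma smooth_body_norm : smooth_norm N.
Proof.
apply: (@smooth_implicit R (c0 R) N body_fun V 1) => //.
- by move=> x y; rewrite mul1r; exact: (gauge_lipschitz body_norm_body).
- exact: (gauge_gt0 body_norm_body).
- by move=> x x0; have [] := gauge_normalize body_norm_body x0.
- exact: norm_body_fun1.
- exact: Ck_body_fun.
- exact: radial_derivative_neq0.
Qed.

End Construction.

(** * The dual norm *)

Section DualNorm.
Variables (R : realType) (N : c0 R -> R).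

Lemma dual_norm_le1 (f : clin (c0 R) R) : N 0 <= 1 ->
  (forall x, N x <= 1 -> `|f x| <= 1) -> dual_norm N f <= 1.
Proof.
move=> N0 f1; apply: ge_sup; first by exists `|f 0|, 0.
by move=> _ [x /= /f1 fx <-].
Qed.

Lemma dual_norm_ge (f : clin (c0 R) R) x :
  (forall x, N x <= 1 -> `|f x| <= 1) -> N x <= 1 -> `|f x| <= dual_norm N f.
Proof.
move=> f1 Nx; apply: ub_le_sup; last by exists x.
by exists 1 => _ [y /= /f1 fy <-].
Qed.

End DualNorm.

(** The functionals [t + s / 2] and [t - s / 2] are the ends of a segment in the
dual unit ball whose midpoint [t] has dual norm 1. The ratios 1/2 and 1/3 could
be any two distinct numbers between 0 and 1. *)
Lemma sup_norm_approximation (R : realType) (eps : R) : 0 < eps ->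
  exists N : c0 R -> R,
      [/\ equivalent_norm N, smooth_norm N,
          ~ strictly_convex (dual_norm N)
        & forall x : c0 R, N x <= `|x| <= (1 + eps) * N x].
Proof.
move=> eps0; have eps1 : 0 < 1 + eps by rewrite addr_gt0.
have h20 : (0 : R) < 2^-1 by rewrite invr_gt0.
have h21 : (2^-1 : R) < 1 by rewrite invf_lt1// ltr1n.
have h30 : (0 : R) < 3^-1 by rewrite invr_gt0.
have h31 : (3^-1 : R) < 1 by rewrite invf_lt1// ltr1n.
have [u [ule uones]] := geometric_functional h20 h21.
have [v [vle vones]] := geometric_functional h30 h31.
pose t : clin (c0 R) R := 2^-1 *: (u + v).
pose s : clin (c0 R) R := 2^-1 *: (u - v).
have tsD x : t x + s x = u x.
  by rewrite [LHS](_ : _ = 2^-1 * (u x + v x) + 2^-1 * (u x - v x))//; field.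
have tsB x : t x - s x = v x.
  by rewrite [LHS](_ : _ = 2^-1 * (u x + v x) - 2^-1 * (u x - v x))//; field.
have u1 x : `|x| <= 1 -> `|t x + s x| < 1.
  by rewrite tsD; exact: (geometric_functional_lt h20 h21 ule uones).
have v1 x : `|x| <= 1 -> `|t x - s x| < 1.
  by rewrite tsB; exact: (geometric_functional_lt h30 h31 vle vones).
pose B := body eps t s.
have BM : norm_body B (1 + eps) := body_norm_body eps0 u1 v1.
have Bball := nb_ball BM.
pose N := gauge B.
have N1 x : N x <= 1 <-> B x := gauge_le1 BM x.
have Nle x : N x <= `|x| := gauge_le_norm BM x.
have leN x : `|x| <= (1 + eps) * N x := norm_le_gauge BM x.
exists N; split=> [||strict|x]; last by rewrite Nle leN.
- split; first exact: (gauge_is_norm BM).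
  exists (1 + eps)^-1, 1; split=> // [|x]; first by rewrite invr_gt0.
  by rewrite mul1r Nle andbT ler_pdivrMl.
- exact: (smooth_body_norm eps0 u1 v1).
have N0 : N 0 <= 1 by apply/N1/Bball; rewrite normr0.
have g1 x : N x <= 1 -> `|t x + 2^-1 * s x| <= 1 /\ `|t x - 2^-1 * s x| <= 1.
  move=> /N1 Bx; have [Vx _] := Bx; apply: lens_in_square => //.
  by rewrite -lens_le1//; exact: (body_lens eps0 Bx).
pose g := t + 2^-1 *: s; pose h := t - 2^-1 *: s.
have gle : dual_norm N g <= 1 by apply: dual_norm_le1 => // x /g1[].
have hle : dual_norm N h <= 1 by apply: dual_norm_le1 => // x /g1[].
have gh : g <> h.
  move=> /(congr1 (fun f : clin (c0 R) R => f (ones R 1))).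
  rewrite [LHS](_ : _ = t (ones R 1) + 2^-1 * s (ones R 1))//.
  rewrite [RHS](_ : _ = t (ones R 1) - 2^-1 * s (ones R 1))//.
  have := tsD (ones R 1); have := tsB (ones R 1); rewrite uones vones !expr1; lra.
have := strict g h gle hle gh.
have -> : 2^-1 *: (g + h) = t.
  apply: clin_ext => x.
  rewrite [LHS](_ : _ = 2^-1 * ((t x + 2^-1 * s x) + (t x - 2^-1 * s x)))//.
  by field.
apply/negP; rewrite -leNgt.
have t1 x : N x <= 1 -> `|t x| <= 1.
  move=> /g1[]; rewrite !ler_norml => /andP[? ?] /andP[? ?].
  by apply/andP; split; lra.
have lim1 : 2^-1 * ((1 - 2^-1 ^+ n) + (1 - 3^-1 ^+ n)) @[n --> \oo] --> (1 : R).
  rewrite [X in _ --> X](_ : _ = 2^-1 * ((1 - 0) + (1 - 0))); last by field.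
  by apply: cvgM; [exact: cvg_cst|apply: cvgD; apply: cvgB; (exact: cvg_cst) ||
    (apply: cvg_expr; rewrite gtr0_norm)].
apply: (cvgr_to_le lim1); near=> n.
rewrite -uones -vones -tsD -tsB (_ : 2^-1 * _ = t (ones R n)); last by field.
apply: le_trans (ler_norm _) _.
apply: dual_norm_ge => //; apply/N1/Bball; exact: ones_norm.
Unshelve. all: by end_near. Qed.

Theorem theorem4 (R : realType) :
  (exists N : c0 R -> R,
      [/\ equivalent_norm N, smooth_norm N
        & ~ strictly_convex (dual_norm N)])
  /\
  (forall eps : R, 0 < eps ->
    exists N : c0 R -> R,
      [/\ equivalent_norm N, smooth_norm N,
          ~ strictly_convex (dual_norm N)
        & forall x : c0 R, N x <= `|x| <= (1 + eps) * N x]).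
Proof.
split; last exact: sup_norm_approximation.
by have [N [? ? ? _]] := sup_norm_approximation (@ltr01 R); exists N.
Qed.
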